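(* For a positive integer vector $B=(b_1,\ldots,b_l)$ define $|B|=\sum_{i=1}^l b_i$ and $\omega(B)=\prod_{i=1}^l \frac{b_i^{b_i}}{b_i!}$. Let $W=(w_{ij})$ be a non-negative real $m\times n$ matrix, let $R_1,\ldots,R_p$ be positive integer $m$-vectors and $C_1,\ldots,C_p$ positive integer $n$-vectors such that $|R_1|=\cdots=|R_p|=|C_1|=\cdots=|C_p|=N$. Let $\alpha_1,\ldots,\alpha_p\ge 0$ with $\alpha_1+\cdots+\alpha_p=1$, and define $R=\sum_{k=1}^p\alpha_kR_k$ and $C=\sum_{k=1}^p\alpha_kC_k$; suppose $R$ and $C$ are positive integer vectors. Then $$\frac{N^N}{N!}\,\frac{T(R,C;W)}{\omega(R)\,\omega(C)}\ \ge\ \prod_{k=1}^p\left(\frac{T(R_k,C_k;W)}{\min\{\omega(R_k),\,\omega(C_k)\}}\right)^{\alpha_k}.$$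
   Context: For a positive integer $m$-vector $R=(r_1,\ldots,r_m)$ and a positive integer $n$-vector $C=(c_1,\ldots,c_n)$ with $\sum_i r_i=\sum_j c_j$, a contingency table with margins $(R,C)$ is an $m\times n$ matrix $D=(d_{ij})$ of non-negative integers with row sums $\sum_j d_{ij}=r_i$ for all $i$ and column sums $\sum_i d_{ij}=c_j$ for all $j$. For a non-negative $m\times n$ matrix $W=(w_{ij})$, $T(R,C;W)=\sum_D\prod_{i,j} w_{ij}^{d_{ij}}$, the sum over all contingency tables $D$ with margins $(R,C)$, with the convention $0^0=1$. *)

(* Defs.v *)
From HB Require Import structures.
From mathcomp Require Import all_boot all_order all_algebra.
From mathcomp Require Import reals exp.
Set Implicit Arguments. Unset Strict Implicit. Unset Printing Implicit Defensive.
Import Order.TTheory GRing.Theory Num.Theory.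
Local Open Scope ring_scope.

Definition vsum (l : nat) (B : 'I_l -> nat) : nat := (\sum_(i < l) B i)%N.

Definition omega (R : realType) (l : nat) (B : 'I_l -> nat) : R :=
  \prod_(i < l) (((B i) ^ (B i))%N%:R / ((B i)`!)%:R).

(* Contingency tables with margins (r,c): m x n nat matrices with row sums r
   and column sums c.  All entries are <= |r|, so we enumerate matrices with
   entries in 'I_(|r|+1); this covers every contingency table. *)
Definition is_table (m n s : nat) (r : 'I_m -> nat) (c : 'I_n -> nat)
  (D : 'M['I_s.+1]_(m, n)) : bool :=
  [forall i, (\sum_(j < n) (D i j : nat))%N == r i] &&
  [forall j, (\sum_(i < m) (D i j : nat))%N == c j].

(* T(R,C;W) = sum over tables D of prod w_ij^d_ij  (with 0^0 = 1) *)
Definition T (R : realType) (m n : nat) (r : 'I_m -> nat) (c : 'I_n -> nat)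
  (W : 'M[R]_(m, n)) : R :=
  \sum_(D : 'M['I_(vsum r).+1]_(m, n) | is_table r c D)
     \prod_(i < m) \prod_(j < n) W i j ^+ (D i j).

(* Main.v *)
(* Write [T(R,C;W)] as the value of P_{R,C}(Z) = \sum_D \prod_ij z_ij^d_ij / d_ij! at
   Z = W x under the functional x_ij^d |-> d!, that is, as the expectation of P_{R,C}(W x) for
   independent standard exponential x_ij. By the Prekopa-Leindler inequality for the exponential
   distribution, it suffices to prove the inequality for P in place of T, jointly in (R, C, Z).

   Since P_{R,C}(Z) is a coefficient of a product of linear forms with nonnegative coefficients,
   P_{R,C}(Z) x^R y^C <= min(omega R, omega C) (\sum_ij x_i z_ij y_j / N)^N for all x, y > 0;
   for fixed x and y this bound is log-concave in (R, C, Z) by AM-GM. In the other direction,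
   Gurvits's capacity form of the van der Waerden inequality gives
   P_{R,C}(Z) >= (N! / N^N) omega R omega C inf_{x,y} x^-R y^-C (\sum_ij x_i z_ij y_j / N)^N.

   Gurvits's bound follows, one column at a time, from the log-concavity of mixed coefficients
   of products of positive linear forms (the Alexandrov-Fenchel inequality for permanents), which
   in turn follows from the stability of such products over the complex numbers. *)
Require Import Defs.
From HB Require Import structures.
From mathcomp Require Import all_boot all_order all_algebra.
From mathcomp Require Import complex.
From mathcomp Require Import boolp classical_sets functions reals exp.
From mathcomp Require Import topology normedtype sequences derive realfun.
From mathcomp Require Import ring lra zify.
From mathcomp Require Import -(notations) mpoly.
Set Implicit Arguments. Unset Strict Implicit. Unset Printing Implicit Defensive.
Import Order.TTheory GRing.Theory Num.Theory numFieldNormedType.Exports.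
Local Open Scope classical_set_scope.
Local Open Scope ring_scope.

Lemma eq_ler (R : numDomainType) (x y : R) : x = y -> x <= y.
Proof. by move=> ->. Qed.

(** * Multinomial expansions *)

(* E_s(X) = \sum_(d <= s) X^d / d! multiplies like the exponential up to degree s. *)
Lemma coef_prod_trunc_exp (A : comNzRingType) (u : nat -> A) (I : Type) (l : seq I)
    (a : I -> A) (s r : nat) :
  (forall d, u d * (d`!)%:R = 1) -> (r <= s)%N ->
  (\prod_(j <- l) \sum_(d < s.+1) (u d * a j ^+ d) *: 'X^d)`_r
    = u r * (\sum_(j <- l) a j) ^+ r.
Proof.
move=> u1; elim: l r => [|j l IH] r rs.
  rewrite !big_nil coef1 expr0n; case: r rs => [|r] _; last by rewrite mulr0.
  by have := u1 0%N; rewrite fact0 => ->.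
rewrite !big_cons coefM exprDn big_distrr /= (reindex_inj rev_ord_inj) /=.
apply: eq_bigr => i _; rewrite subSS subKn ?(leq_ord i) //.
rewrite IH ?(leq_trans (leq_ord i)) // -(poly_def s.+1 (fun d => u d * a j ^+ d)) coef_poly ltnS.
rewrite (leq_trans (leq_subr _ _) rs).
have uE : u r * 'C(r, i)%:R = u (r - i)%N * u i.
  have ir : (i <= r)%N by rewrite -ltnS.
  have e3 := u1 r; rewrite -(bin_fact ir) !natrM in e3.
  transitivity (u r * 'C(r, i)%:R * (u (r - i)%N * ((r - i)`!)%:R) * (u i * (i`!)%:R)).
    by rewrite !u1 !mulr1.
  transitivity (u (r - i)%N * u i * (u r * ('C(r, i)%:R * ((i`!)%:R * ((r - i)`!)%:R)))).
    ring.
  by rewrite e3 mulr1.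
set S := \sum_(j0 <- l) a j0; rewrite -mulr_natr.
by rewrite [RHS](_ : _ = u r * 'C(r, i)%:R * (a j ^+ (r - i) * S ^+ i));
  [rewrite uE|]; ring.
Qed.

(** Reads the coefficient of X^r in a product of truncated exponentials in two ways. An abstract
    inverse [u d] of d! replaces division, so that the identity also applies over a polynomial
    ring. *)
Lemma multinomial_divided (A : comNzRingType) (u : nat -> A) (n : nat)
    (a : 'I_n -> A) (s r : nat) :
  (forall d, u d * (d`!)%:R = 1) -> (r <= s)%N ->
  u r * (\sum_j a j) ^+ r
    = \sum_(d : {ffun 'I_n -> 'I_s.+1} | (\sum_j (d j : nat))%N == r)
         \prod_j (u (d j) * a j ^+ (d j)).
Proof.
move=> u1 rs; rewrite -(coef_prod_trunc_exp _ a u1 rs) bigA_distr_bigA /=.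
rewrite coef_sum [RHS]big_mkcond /=; apply: eq_bigr => d _.
rewrite scaler_prod -expr_sum coefZ coefXn eq_sym.
by case: eqP => _; rewrite ?mulr1 ?mulr0.
Qed.

(** All roots r have negative real part, so P'(0) / P(0) = \sum -1/r has positive real part; the sum
    is nonempty because P is not constant. *)
Lemma stable_coef1_neq0 (R : rcfType) (P : {poly R[i]}) :
  (1 < size P)%N -> (forall t, 0 <= complex.Re t -> P.[t] != 0) -> P`_1 != 0.
Proof.
move=> sP nz; have [rs Prs] := closed_field_poly_normal P.
have lP : lead_coef P != 0.
  by rewrite lead_coef_eq0 -size_poly_gt0 (ltn_trans _ sP).
have rs_neg : all (fun r => complex.Re r < 0) rs.
  apply/allP => r rin; rewrite ltNge; apply/negP => /nz /negP; apply.
  by rewrite -rootE Prs rootZ // root_prod_XsubC.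
have rs_nil : rs != [::].
  apply: contraTneq sP => rs0.
  by rewrite Prs rs0 big_nil size_scale // size_poly1.
have key (l : seq R[i]) : all (fun r => complex.Re r < 0) l ->
    let Q := \prod_(r <- l) ('X - r%:P) in
    Q.[0] != 0 /\ (if l == [::] then 0 = complex.Re (Q^`().[0] / Q.[0])
                   else 0 < complex.Re (Q^`().[0] / Q.[0])).
  elim: l => [|r l IH] /=.
    by rewrite big_nil derivC !hornerE oner_eq0; split=> //; rewrite ?invr1 ?mulr1.
  case/andP=> r0 /IH [] {IH}.
  rewrite !big_cons; set Q := \prod_(_ <- _) _ => Q0 IH.
  have rn0 : r != 0 by apply: contraTneq r0 => ->; rewrite ltxx.
  rewrite derivM derivB derivX derivC !hornerE; split.
    by rewrite mulf_neq0 ?oppr_eq0.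
  rewrite (_ : _ / _ = - r^-1 + Q^`().[0] / Q.[0]); last first.
    by field; rewrite Q0 rn0.
  have h1 : 0 < complex.Re (- r^-1).
    case: r r0 rn0 => x y /= x0 _; rewrite -mulNr divr_gt0 ?oppr_gt0 //.
    by rewrite ltr_pwDl ?sqr_ge0 // exprn_even_gt0 //= lt_eqF.
  rewrite raddfD /=; apply: ltr_pwDl => //.
  by case: ifP IH => _ => [<-|/ltW].
have [Q0] := key _ rs_neg; rewrite (negPf rs_nil) => hQ.
have : P^`().[0] != 0.
  rewrite Prs derivZ hornerZ mulf_neq0 //.
  by apply: contraTneq hQ => ->; rewrite mul0r ltxx.
by rewrite horner_coef0 coef_deriv.
Qed.

Lemma prod_multinomial_divided (A : comNzRingType) (u : nat -> A) (m n : nat)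
    (a : 'I_m -> 'I_n -> A) (c : 'I_n -> nat) (s : nat) :
  (forall d, u d * (d`!)%:R = 1) -> (forall j, (c j <= s)%N) ->
  \prod_j (u (c j) * (\sum_i a i j) ^+ c j)
    = \sum_(D : 'M['I_s.+1]_(m, n) | [forall j, (\sum_i (D i j : nat))%N == c j])
         \prod_i \prod_j (u (D i j) * a i j ^+ (D i j)).
Proof.
move=> u1 cs; under eq_bigr => j _ do rewrite (multinomial_divided _ u1 (cs j)).
rewrite bigA_distr_big_dep /=.
(* [h] and [g] identify a matrix with the family of its columns, the index set produced by expanding
   the product of column powers. *)
pose h (D : 'M['I_s.+1]_(m, n)) := [ffun j => [ffun i => D i j]].
pose g (f : {ffun 'I_n -> {ffun 'I_m -> 'I_s.+1}}) := \matrix_(i, j) f j i.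
rewrite (reindex h); last first.
  exists g => [D|f] _; first by apply/matrixP => i j; rewrite mxE !ffunE.
  by apply/ffunP => j; apply/ffunP => i; rewrite !ffunE mxE.
apply: eq_big => [D|D _].
  have hE j : (\sum_i (h D j i : nat))%N = (\sum_i (D i j : nat))%N.
    by apply: eq_bigr => i _; rewrite /h !ffunE.
  by apply/familyP/forallP => H j; have := H j; rewrite ?inE /in_mem /= hE.
rewrite [RHS]exchange_big /=; apply: eq_bigr => j _; apply: eq_bigr => i _.
by rewrite /h !ffunE.
Qed.

(** * Coefficients of products of linear forms *)

Definition mon (m : nat) (r : 'I_m -> nat) : multinom m :=
  Multinom [tuple r i | i < m].

Definition lin (F : nzRingType) (m : nat) (v : 'I_m -> F) : mpoly m F :=
  \sum_i v i *: mpolyX F (mnm1 i).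

Lemma mcoeff_monomial (F : comNzRingType) (m : nat) (r d : 'I_m -> nat) (c : F) :
  mcoeff (mon r) (c *: \prod_i mpolyX F (mnm1 i) ^+ d i)
    = c * [forall i, d i == r i]%:R.
Proof.
rewrite mcoeffZ; congr (_ * _).
have -> : \prod_i mpolyX F (mnm1 i) ^+ d i = mpolyX F (mon d).
  by rewrite mpolyXE_id; apply: eq_bigr => i _; rewrite mnmE.
rewrite mcoeffX; congr ((nat_of_bool _)%:R).
apply/eqP/forallP => [/mnmP H i|H]; first by have := H i; rewrite !mnmE => ->.
by apply/mnmP => i; rewrite !mnmE; apply/eqP.
Qed.

(** The column expansion is applied over the polynomial ring to the terms z_ij x_i. The exponent of
    x_i in the term of D is then the i-th row sum, so extracting x^r imposes the row margins. *)
Lemma mcoeff_prod_lin (F : numFieldType) (m n s : nat) (z : 'I_m -> 'I_n -> F)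
    (r : 'I_m -> nat) (c : 'I_n -> nat) :
  (forall j, (c j <= s)%N) ->
  mcoeff (mon r) (\prod_j lin (z^~ j) ^+ c j)
    = (\prod_j (c j)`!%:R) *
      \sum_(D : 'M['I_s.+1]_(m, n) | [forall i, (\sum_j (D i j : nat))%N == r i]
                                  && [forall j, (\sum_i (D i j : nat))%N == c j])
         \prod_i \prod_j (z i j ^+ D i j / (D i j)`!%:R).
Proof.
move=> cs; pose v d := (d`!)%:R^-1 : F; pose u d := mpolyC m (v d).
have f0 d : (d`!)%:R != 0 :> F by rewrite pnatr_eq0 -lt0n fact_gt0.
have u1 d : u d * (d`!)%:R = 1.
  by rewrite mul_mpolyC -scaler_nat scalerA mulVf ?scale1r.
have /(congr1 (mcoeff (mon r))) :=
  prod_multinomial_divided (fun i j => z i j *: mpolyX F (mnm1 i)) u1 cs.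
rewrite big_split /= -rmorph_prod mul_mpolyC mcoeffZ => /(congr1 ( *%R (\prod_j (c j)`!%:R))).
rewrite mulrA -big_split /= big1 ?mul1r => [->|j _]; last by rewrite mulfV.
congr (_ * _); rewrite raddf_sum /= [RHS]big_mkcondl /=; apply: eq_bigr => D _.
have -> : \prod_i \prod_j (u (D i j) * (z i j *: mpolyX F (mnm1 i)) ^+ D i j)
    = (\prod_i \prod_j (z i j ^+ D i j / (D i j)`!%:R)) *:
      \prod_i mpolyX F (mnm1 i) ^+ (\sum_j (D i j : nat))%N.
  rewrite -scaler_prod; apply: eq_bigr => i _.
  rewrite expr_sum -scaler_prod; apply: eq_bigr => j _.
  by rewrite exprZn mul_mpolyC scalerA mulrC.
by rewrite mcoeff_monomial; case: [forall i, _]; rewrite ?mulr1 ?mulr0.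
Qed.

Lemma mcoeff_lin_pow (F : numFieldType) (m : nat) (z : 'I_m -> F) (r : 'I_m -> nat) (N : nat) :
  (\sum_i r i)%N = N ->
  mcoeff (mon r) (lin z ^+ N) = (N`!)%:R * \prod_i (z i ^+ r i / (r i)`!%:R).
Proof.
move=> rN; have := @mcoeff_prod_lin F m 1 N (fun i _ => z i) r (fun=> N) (fun=> leqnn N).
rewrite !big_ord1 => ->; congr (_ * _).
pose D0 : 'M['I_N.+1]_(m, 1) := \matrix_(i, j) inord (r i).
have rle i : (r i < N.+1)%N by rewrite ltnS -rN (bigD1 i) //= leq_addr.
rewrite (big_pred1 D0) => [|D /=].
  by apply: eq_bigr => i _; rewrite big_ord1 mxE inordK.
apply/andP/eqP => [[/forallP H _]|->].
  apply/matrixP => i j; rewrite mxE (ord1 j); apply: val_inj.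
  by rewrite /= inordK //; have := H i; rewrite big_ord1 => /eqP.
split; apply/forallP => i; first by rewrite big_ord1 mxE inordK.
by under eq_bigr => k _ do rewrite mxE inordK //; rewrite rN.
Qed.

Lemma lin_add (F : comNzRingType) (m : nat) (x y : 'I_m -> F) (t : F) :
  lin (fun i => x i + t * y i) = lin x + t *: lin y.
Proof.
rewrite /lin scaler_sumr -big_split /=; apply: eq_bigr => i _.
by rewrite scalerDl scalerA.
Qed.

(** Turns the coefficient into a polynomial in t whose coefficients are mixed coefficients: complex
    t serves stability, real t the capacity recursion. *)
Lemma mcoeff_binomial (F : comNzRingType) (m : nat) (r : 'I_m -> nat)
    (x y : 'I_m -> F) (t : F) (k : nat) (q : mpoly m F) :
  mcoeff (mon r) (lin (fun i => x i + t * y i) ^+ k * q)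
  = \sum_(i < k.+1) ('C(k, i)%:R * mcoeff (mon r) (lin x ^+ (k - i) * lin y ^+ i * q)) * t ^+ i.
Proof.
rewrite lin_add exprDn mulr_suml raddf_sum /=; apply: eq_bigr => i _.
rewrite -mul_mpolyC exprMn -rmorphXn /=.
rewrite (_ : _ * q = (mpolyC m (t ^+ i) * (lin x ^+ (k - i) * lin y ^+ i * q)) *+ 'C(k, i)).
  by rewrite raddfMn /= mcoeffCM mulr_natl mulrnAl; congr (_ *+ _); rewrite mulrC.
by rewrite mulrnAl mulrCA !mulrA.
Qed.

(** * Mixed coefficients of products of positive linear forms *)

Lemma lin_scale (F : comNzRingType) (m : nat) (x : 'I_m -> F) (c : F) :
  lin (fun i => c * x i) = mpolyC m c * lin x.
Proof.
rewrite mul_mpolyC /lin scaler_sumr; apply: eq_bigr => i _.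
by rewrite scalerA.
Qed.

Lemma map_lin (F K : comNzRingType) (f : {rmorphism F -> K}) (m : nat) (x : 'I_m -> F) :
  map_mpoly f (lin x) = lin (f \o x).
Proof.
by rewrite raddf_sum; apply: eq_bigr => i _ /=; rewrite map_mpolyZ map_mpolyX.
Qed.

(** The index counts the factors and is therefore the degree; peeling off one factor at a time is
    the induction behind stability. *)
Inductive posprod (R : numDomainType) (m : nat) : nat -> mpoly m R -> Prop :=
| posprod_nil : posprod 0 1
| posprod_cons k (a : 'I_m -> R) q :
    (forall i, 0 < a i) -> posprod k q -> posprod k.+1 (lin a * q).

Lemma posprod_expl (R : numDomainType) (m : nat) (a : 'I_m -> R) k j q :
  (forall i, 0 < a i) -> posprod k q -> posprod (j + k) (lin a ^+ j * q).
Proof.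
move=> a0 hq; elim: j => [|j IH]; first by rewrite expr0 mul1r.
by rewrite exprS -mulrA addSn; apply: posprod_cons.
Qed.

(* Gauss-Lucas: the mixed coefficient is (up to a factor) the derivative at 0 of a
   polynomial all of whose roots lie in the open left half-plane. *)
Lemma mcoeff_posprod_stable (R : rcfType) (m : nat) (r : 'I_m -> nat) j (q : mpoly m R) :
  posprod j q -> forall k (z : 'I_m -> R[i]), (j + k)%N = (\sum_i r i)%N ->
  (forall i, 0 < complex.Re (z i)) ->
  mcoeff (mon r) (lin z ^+ k * map_mpoly (real_complex R) q) != 0.
Proof.
elim=> [|{}j a {}q a0 hq IH] k z jk z0.
  rewrite rmorph1 mulr1 (mcoeff_lin_pow z (esym jk)) mulf_neq0 //.
    by rewrite pnatr_eq0 -lt0n fact_gt0.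
  apply/prodf_neq0 => i _; rewrite mulf_neq0 ?invr_eq0 ?pnatr_eq0 -?lt0n ?fact_gt0 //.
  by rewrite expf_neq0 //; apply: contraTneq (z0 i) => ->; rewrite ltxx.
rewrite rmorphM /= map_lin; set mq := map_mpoly _ q; set ac := _ \o a.
rewrite mulrA.
have jk1 : (j + k.+1 = \sum_i r i)%N by rewrite addnS -addSn.
have ac0 i : 0 < complex.Re (ac i) by rewrite /ac /= a0.
pose co i := 'C(k.+1, i)%:R * mcoeff (mon r) (lin z ^+ (k.+1 - i) * lin ac ^+ i * mq).
pose P := \poly_(i < k.+2) co i.
have P1 : P`_1 = k.+1%:R * mcoeff (mon r) (lin z ^+ k * lin ac * mq).
  by rewrite coef_poly /co /= bin1 subn1 expr1.
suff : P`_1 != 0 by rewrite P1 mulf_eq0 negb_or => /andP[].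
apply: stable_coef1_neq0.
  (* The top coefficient is the mixed coefficient with [z] replaced by [ac], nonzero by induction,
     so P is not constant. *)
  rewrite size_poly_eq // /co binn subnn expr0 !mul1r.
  exact: IH.
(* For Re t >= 0 the coefficients z_i + t a_i still have positive real part, so induction gives a
   nonzero value at t. *)
move=> t t0; rewrite horner_poly /co -mcoeff_binomial; apply: IH => // i.
rewrite raddfD /=; apply: ltr_pwDl => //.
by case: t t0 => t1 t2 /= t0; rewrite mulr0 subr0 mulr_ge0 // ltW.
Qed.

Lemma mcoeff_posprod_ge0 (R : numDomainType) (m : nat) j (q : mpoly m R) :
  posprod j q -> forall e, 0 <= mcoeff e q.
Proof.
elim=> [|{}j a {}q a0 hq IH] e; first by rewrite mcoeff1 ler0n.
rewrite (mcoeffM _ _ e); apply: sumr_ge0 => k _; rewrite mulr_ge0 //.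
rewrite raddf_sum; apply: sumr_ge0 => i _ /=.
by rewrite mcoeffZ mcoeffX mulr_ge0 ?ler0n // ltW.
Qed.

(** Positive factors give nonnegativity; stability with exponent k = 0 excludes zero. *)
Lemma mcoeff_posprod_gt0 (R : rcfType) (m : nat) (r : 'I_m -> nat) (q : mpoly m R) :
  posprod (\sum_i r i)%N q -> 0 < mcoeff (mon r) q.
Proof.
move=> hq; rewrite lt_neqAle (mcoeff_posprod_ge0 hq) andbT eq_sym.
have := @mcoeff_posprod_stable R m r _ q hq 0 (fun=> 1) (addn0 _) (fun=> ltr01).
by rewrite expr0 mul1r mcoeff_map_mpoly /= fmorph_eq0.
Qed.

Lemma mcoeff_sqr (F : comNzRingType) (m : nat) (r : 'I_m -> nat)
    (x y : 'I_m -> F) (t : F) (q : mpoly m F) :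
  mcoeff (mon r) (lin (fun i => x i + t * y i) ^+ 2 * q)
  = mcoeff (mon r) (lin x ^+ 2 * q) + t * mcoeff (mon r) (lin x * lin y * q) *+ 2
    + t ^+ 2 * mcoeff (mon r) (lin y ^+ 2 * q).
Proof.
rewrite lin_add -mul_mpolyC; move: (lin x) (lin y) => X Y.
rewrite sqrrD 2!mulrDl 2!mcoeffD; congr (_ + _ + _).
  by rewrite mulrnAl mulrCA -(mulrA (mpolyC m t)) raddfMn /= mcoeffCM.
by rewrite exprMn -rmorphXn /= -mulrA mcoeffCM.
Qed.

Lemma mcoeff_sqr_map (F K : comNzRingType) (f : {rmorphism F -> K}) (m : nat)
    (r : 'I_m -> nat) (x y : 'I_m -> F) (l t : K) (q : mpoly m F) :
  mcoeff (mon r) (lin (fun i => l * (f (x i) + t * f (y i))) ^+ 2 * map_mpoly f q)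
  = l ^+ 2 * (f (mcoeff (mon r) (lin x ^+ 2 * q))
    + t * f (mcoeff (mon r) (lin x * lin y * q)) *+ 2
    + t ^+ 2 * f (mcoeff (mon r) (lin y ^+ 2 * q))).
Proof.
rewrite (lin_scale (fun i => f (x i) + t * f (y i))) exprMn -rmorphXn /=.
rewrite -(mulrA (mpolyC m (l ^+ 2))) mcoeffCM mcoeff_sqr -!mcoeff_map_mpoly.
by rewrite !expr2 !rmorphM /= !map_lin.
Qed.

(** If the inequality failed, the quadratic A + 2 B t + D t^2 would have a nonreal root t. A
    suitable scalar l moves all l (x_i + t y_i) into the open right half-plane, where stability
    forbids the coefficient to vanish. *)
Lemma mcoeff_Alexandrov_Fenchel (R : rcfType) (m : nat) (r : 'I_m -> nat) j
    (q : mpoly m R) (x y : 'I_m -> R) :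
  posprod j q -> (j + 2)%N = (\sum_i r i)%N ->
  (forall i, 0 < x i) -> (forall i, 0 < y i) ->
  mcoeff (mon r) (lin x ^+ 2 * q) * mcoeff (mon r) (lin y ^+ 2 * q)
    <= mcoeff (mon r) (lin x * lin y * q) ^+ 2.
Proof.
move=> hq jr x0 y0; rewrite leNgt; apply/negP.
set A := mcoeff _ (lin x ^+ 2 * q); set D := mcoeff _ (lin y ^+ 2 * q).
set B := mcoeff _ _ => lt.
have D0 : D != 0 by apply: contraTneq lt => ->; rewrite mulr0 -leNgt sqr_ge0.
pose d := Num.sqrt (A * D - B ^+ 2).
have d2 : d ^+ 2 = A * D - B ^+ 2 by rewrite sqr_sqrtr // subr_ge0 ltW.
have d0 : d != 0 by rewrite gt_eqF // sqrtr_gt0 subr_gt0.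
(* The root is t = u + i v. Since u + s v = 1, the real part of l (x_i + t y_i) with l = 1 - i s is
   x_i + y_i. *)
pose u := - B / D; pose v := d / D; pose s := (1 - u) / v.
have v0 : v != 0 by rewrite mulf_neq0 // invr_eq0.
pose t : R[i] := (u +i* v)%C; pose l : R[i] := (1 -i* s)%C.
pose f := real_complex R.
pose z i := l * (f (x i) + t * f (y i)).
have z0 i : 0 < complex.Re (z i).
  rewrite /z /f /= !(mulr0, mul0r, subr0, addr0, add0r, mul1r).
  rewrite (_ : _ - _ = x i + y i) ?addr_gt0 //.
  by rewrite /s; field.
have /eqP := mcoeff_posprod_stable hq jr z0; apply.
apply: etrans (mcoeff_sqr_map _ _ _ _ _ _ _) _; rewrite -/A -/B -/D.
apply/eqP; rewrite mulf_eq0; apply/orP; right.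
rewrite eq_complex /=.
have e1 : A + 2 * u * B + (u ^+ 2 - v ^+ 2) * D = 0.
  by rewrite /u /v !expr_div_n d2; field.
have e2 : 2 * v * B + 2 * u * v * D = 0 by rewrite /u; field.
apply/andP; split; apply/eqP.
  by rewrite -[RHS]e1; ring.
by rewrite -[RHS]e2; ring.
Qed.

(** * Capacity bounds *)

(* With s = a_(c+1) / a_c, log-concavity gives a_i <= a_c s^(i-c), so the polynomial is at most
   a_c s^-c (1 + s t)^k; take t = c / ((k - c) s). *)
Lemma logconcave_capacity (R : realFieldType) (k c : nat) (a : nat -> R) (K : R) :
  (0 < c < k)%N -> (forall i, (i <= k)%N -> 0 < a i) ->
  (forall i, (i.+2 <= k)%N -> a i * a i.+2 <= a i.+1 ^+ 2) ->
  (forall t, 0 < t -> K * t ^+ c <= \sum_(i < k.+1) 'C(k, i)%:R * a i * t ^+ i) ->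
  K * (c ^ c * (k - c) ^ (k - c))%:R <= a c * (k ^ k)%:R.
Proof.
move=> /andP[c0 ck] a0 alc hK.
(* The ratios a_(i+1) / a_i do not increase, in cross-multiplied form. *)
have ratio i j : (i <= j)%N -> (j < k)%N -> a j.+1 * a i <= a i.+1 * a j.
  elim: j => [|j IH]; first by rewrite leqn0 => /eqP -> _.
  rewrite leq_eqVlt => /predU1P[-> _|ij jk]; first by rewrite mulrC.
  have aj := a0 _ (ltnW (ltnW jk)); rewrite -(ler_pM2l aj).
  have h : a j.+1 * (a j.+1 * a i) <= a j.+1 * (a i.+1 * a j).
    by rewrite ler_pM2l; [apply: IH => //; apply: ltnW | apply/a0/ltnW].
  have le1 : a j * (a j.+2 * a i) <= a j.+1 * (a j.+1 * a i).
    rewrite !mulrA -expr2 ler_wpM2r ?alc // ltW // a0 //.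
    by apply: leq_trans (ltnW (ltnW jk)).
  apply: (le_trans le1); rewrite (_ : a j * _ = a j.+1 * (a i.+1 * a j)) //; ring.
pose s := a c.+1 / a c.
have ac := a0 _ (ltnW ck); have s0 : 0 < s by apply: divr_gt0 => //; apply: a0.
have sE : a c * s = a c.+1 by rewrite mulrC divfK ?gt_eqF.
have up d : (c + d <= k)%N -> a (c + d)%N <= a c * s ^+ d.
  elim: d => [|d IH]; first by rewrite addn0 mulr1.
  rewrite addnS => cd; have := ratio _ _ (leq_addr d c) cd.
  rewrite -sE -mulrA mulrC ler_pM2l // => /le_trans; apply.
  by rewrite exprS mulrCA ler_pM2l // IH // ltnW.
have down d : (d <= c)%N -> a (c - d)%N * s ^+ d <= a c.
  elim: d => [|d IH] dc; first by rewrite subn0 mulr1.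
  have := ratio _ _ (leq_subr d.+1 c) ck.
  rewrite subnSK // -sE -mulrA [leRHS]mulrC ler_pM2l // => h.
  apply: le_trans (IH (ltnW dc)); rewrite exprS mulrA ler_pM2r ?exprn_gt0 //.
  by rewrite mulrC.
have bound i : (i <= k)%N -> a i * s ^+ c <= a c * s ^+ i.
  move=> ik; case: (leqP c i) => ci.
    rewrite -(subnKC ci) exprD mulrA mulrAC ler_pM2r ?exprn_gt0 //.
    by rewrite up // subnKC.
  rewrite -{1}(subnK (ltnW ci)) exprD mulrA ler_pM2r ?exprn_gt0 //.
  by have := down (c - i)%N (leq_subr _ _); rewrite subKn // ltnW.
have tot t : 0 < t -> K * t ^+ c * s ^+ c <= a c * (1 + t * s) ^+ k.
  move=> t0; apply: le_trans (_ : (\sum_(i < k.+1) 'C(k, i)%:R * a i * t ^+ i) * s ^+ c <= _).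
    by rewrite ler_pM2r ?exprn_gt0 // hK.
  rewrite exprDn mulr_suml mulr_sumr ler_sum // => i _.
  rewrite expr1n mul1r [(t * s) ^+ i]exprMn -[X in a c * X]mulr_natl.
  have -> : 'C(k, i)%:R * a i * t ^+ i * s ^+ c = 'C(k, i)%:R * t ^+ i * (a i * s ^+ c) by ring.
  have -> : a c * ('C(k, i)%:R * (t ^+ i * s ^+ i)) = 'C(k, i)%:R * t ^+ i * (a c * s ^+ i) by ring.
  by rewrite ler_wpM2l ?bound ?leq_ord // mulr_ge0 ?ler0n // exprn_ge0 // ltW.
pose C : R := c%:R; pose D : R := (k - c)%:R.
have C0 : 0 < C by rewrite ltr0n.
have D0 : 0 < D by rewrite ltr0n subn_gt0.
have kE : k%:R = D + C :> R by rewrite -natrD subnK // ltnW.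
have /tot : 0 < C / D / s by apply: divr_gt0 => //; apply: divr_gt0.
rewrite -mulrA -exprMn divfK ?gt_eqF //.
have -> : 1 + C / D = k%:R / D by rewrite kE; field; rewrite gt_eqF.
rewrite !expr_div_n -/D mulrA ler_pdivrMr ?exprn_gt0 // => h.
rewrite natrM !natrX -/C -/D mulrA.
have Dp : 0 < D ^+ (k - c) by rewrite exprn_gt0.
rewrite -(ler_pM2r Dp) in h; apply: le_trans h _.
rewrite -mulrA -exprD addnC subnK ?(ltnW ck) // -mulrA divfK //.
by rewrite expf_neq0 // gt_eqF.
Qed.

Lemma regroup_powers (A : comNzRingType) (X Y q : A) (d i : nat) :
  [/\ X ^+ 2 * (X ^+ d * (Y ^+ i * q)) = X ^+ d.+2 * Y ^+ i * q,
      Y ^+ 2 * (X ^+ d * (Y ^+ i * q)) = X ^+ d * Y ^+ i.+2 * q &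
      X * Y * (X ^+ d * (Y ^+ i * q)) = X ^+ d.+1 * Y ^+ i.+1 * q].
Proof. by split; rewrite !exprS; ring. Qed.

Lemma eq_lin (F : comNzRingType) (m : nat) (x y : 'I_m -> F) : x =1 y -> lin x = lin y.
Proof. by move=> xy; apply: eq_bigr => i _; rewrite xy. Qed.

(* One column at a time; the constants c^c (k-c)^(k-c) / k^k telescope. *)
Lemma posprod_capacity (R : rcfType) (m n : nat) (r : 'I_m -> nat)
    (z : 'I_m -> 'I_n -> R) (c : 'I_n -> nat) (js : seq 'I_n) :
  (forall i j, 0 < z i j) -> (forall j, (0 < c j)%N) -> uniq js ->
  forall k l (q : mpoly m R) (K : R),
  posprod l q -> (l + k = \sum_i r i)%N -> k = (\sum_(j <- js) c j)%N ->
  (forall y : 'I_n -> R, (forall j, 0 < y j) ->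
    K * \prod_(j <- js) y j ^+ c j
      <= mcoeff (mon r) (lin (fun i => \sum_(j <- js) y j * z i j) ^+ k * q)) ->
  K * (\prod_(j <- js) c j ^ c j)%:R
    <= mcoeff (mon r) (\prod_(j <- js) lin (z^~ j) ^+ c j * q) * (k ^ k)%:R.
Proof.
move=> z0 c0; elim: js => [_|j js IH /= /andP[jjs ujs]] k l q K hq lk kE hK.
  rewrite big_nil in kE; subst k.
  have := hK (fun=> 1) (fun=> ltr01); rewrite !big_nil expr0 !mul1r mulr1.
  by rewrite expn0 !mulr1.
(* The last column is treated apart, since the log-concavity bound needs c_j < k. *)
case: (posnP (size js)) => [/size0nil js0|js_gt0].
  have kc : k = c j by rewrite kE js0 big_seq1.
  have := hK (fun=> 1) (fun=> ltr01); rewrite js0 !big_seq1 expr1n mulr1 kc.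
  rewrite (@eq_lin _ _ _ (z^~ j)) => [h|i]; last by rewrite big_seq1 mul1r.
  by rewrite ler_wpM2r.
pose k' := (\sum_(j <- js) c j)%N.
have {}kE : k = (c j + k')%N by rewrite kE big_cons.
have k'0 : (0 < k')%N.
  by case: js js_gt0 @k' {IH jjs ujs hK kE} => // j' js _ /=; rewrite big_cons addn_gt0 c0.
have nat_gt0 d : 0 < (d ^ d)%:R :> R by rewrite ltr0n expn_gt0; case: d.
have hq' : posprod (c j + l) (lin (z^~ j) ^+ c j * q) by apply: posprod_expl.
have lk' : (c j + l + k' = \sum_i r i)%N by rewrite -lk kE; lia.
(* The induction hypothesis is applied with column j moved into the fixed factor and with K
   multiplied by the cost of this move. *)
suff h : K * (c j ^ c j * k' ^ k')%:R / (k ^ k)%:R * (\prod_(j0 <- js) c j0 ^ c j0)%:R <=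
    mcoeff (mon r) (\prod_(j0 <- js) lin (z^~ j0) ^+ c j0 * (lin (z^~ j) ^+ c j * q)) *
    (k' ^ k')%:R.
  rewrite -(ler_pM2r (nat_gt0 k')) !big_cons.
  rewrite [lin _ ^+ c j * _]mulrC -(mulrA _ (lin (z^~ j) ^+ c j)) [leRHS]mulrAC.
  rewrite -(ler_pM2r (nat_gt0 k)) in h; apply: le_trans h.
  apply: eq_ler; rewrite !natrM.
  by field; rewrite gt_eqF.
apply: (IH ujs k' _ _ _ hq' lk' erefl) => y y0.
rewrite -(ler_pM2r (nat_gt0 k)).
pose x i := \sum_(j0 <- js) y j0 * z i j0.
have x0 i : 0 < x i.
  rewrite /x; case: js js_gt0 {IH jjs ujs hK k' kE k'0 hq' lk' x} => // j' js _.
  rewrite big_cons ltr_pwDl ?mulr_gt0 //.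
  by apply: sumr_ge0 => j0 _; rewrite mulr_ge0 // ltW.
(* These mixed coefficients interpolate between the form [x] of the remaining columns and that of
   column j; the index c_j is the one wanted. *)
pose a i := mcoeff (mon r) (lin x ^+ (k - i) * lin (z^~ j) ^+ i * q).
have hpos i : (i <= k)%N -> posprod (l + k) (lin x ^+ (k - i) * lin (z^~ j) ^+ i * q).
  move=> ik; rewrite -mulrA (_ : l + k = (k - i) + (i + l))%N; last by lia.
  by apply: posprod_expl => //; apply: posprod_expl.
have cE : (k - c j)%N = k' by rewrite kE addKn.
have := @logconcave_capacity R k (c j) a (K * \prod_(j0 <- js) y j0 ^+ c j0).
rewrite cE [a (c j)]/a cE -mulrA => h.
apply: le_trans (_ : K * \prod_(j0 <- js) y j0 ^+ c j0 * (c j ^ c j * k' ^ k')%:R <= _).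
  by apply: eq_ler; field; rewrite gt_eqF.
apply: h.
- by rewrite c0 kE -[X in (X < _)%N]addn0 ltn_add2l.
- by move=> i ik; apply: mcoeff_posprod_gt0; rewrite -lk; apply: hpos.
- move=> i ik.
  pose q' := lin x ^+ (k - i.+2) * (lin (z^~ j) ^+ i * q).
  have hq2 : posprod (k - i.+2 + (i + l)) q' by apply: posprod_expl => //; apply: posprod_expl.
  have := @mcoeff_Alexandrov_Fenchel R m r _ q' x (z^~ j) hq2 _ x0 (z0^~ j).
  have [e1 e2 e3] := regroup_powers (lin x) (lin (z^~ j)) q (k - i.+2) i.
  rewrite /q' e1 e2 e3 /a (_ : k - i = (k - i.+2).+2)%N; last by lia.
  rewrite (_ : k - i.+1 = (k - i.+2).+1)%N; last by lia.
  by apply; lia.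
- move=> t t0.
  (* Giving column j the weight t turns the hypothesis on K into the required polynomial bound in
     t. *)
  pose y' j0 := if j0 == j then t else y j0.
  have y'0 j0 : 0 < y' j0 by rewrite /y'; case: eqP.
  have y'js j0 : j0 \in js -> y' j0 = y j0.
    by move=> jin; rewrite /y'; case: eqP jin => // ->; rewrite (negPf jjs).
  have := hK y' y'0; rewrite big_cons {1}/y' eqxx.
  rewrite (@eq_big_seq _ _ _ _ _ (fun j => y' j ^+ c j) (fun j => y j ^+ c j)); last first.
    by move=> j0 /y'js ->.
  rewrite (@eq_lin _ _ _ (fun i => x i + t * z i j)) => [|i]; last first.
    rewrite big_cons /y' eqxx addrC; congr (_ + _).
    by apply: eq_big_seq => j0 /y'js; rewrite /y' => ->.
  by rewrite mcoeff_binomial mulrCA mulrC.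
Qed.

(** The polynomial P_{R,C}. The entry bound [s] is separate from the margins, so that tables for
    different margins of the same total share one index type. *)
Definition ctpoly (R : numFieldType) (m n s : nat) (r : 'I_m -> nat) (c : 'I_n -> nat)
    (Z : 'M[R]_(m, n)) : R :=
  \sum_(D : 'M['I_s.+1]_(m, n) | is_table r c D)
     \prod_i \prod_j (Z i j ^+ D i j / (D i j)`!%:R).

Lemma ctpoly_ge0 (R : numFieldType) (m n s : nat) (r : 'I_m -> nat) (c : 'I_n -> nat)
    (Z : 'M[R]_(m, n)) : (forall i j, 0 <= Z i j) -> 0 <= ctpoly s r c Z.
Proof.
move=> Z0; apply: sumr_ge0 => D _; apply: prodr_ge0 => i _; apply: prodr_ge0 => j _.
by rewrite divr_ge0 ?ler0n // exprn_ge0.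
Qed.

Lemma ctpoly_tr (R : numFieldType) (m n s : nat) (r : 'I_m -> nat) (c : 'I_n -> nat)
    (Z : 'M[R]_(m, n)) : ctpoly s c r Z^T = ctpoly s r c Z.
Proof.
rewrite /ctpoly (reindex (fun D : 'M['I_s.+1]_(m, n) => D^T)%R) /=; last first.
  by exists (fun D => D^T)%R => D _; rewrite trmxK.
apply: eq_big => [D|D _]; last first.
  by rewrite exchange_big; do 2!apply: eq_bigr => ? _; rewrite !mxE.
by rewrite /is_table andbC; congr (_ && _); apply: eq_forallb => k;
  under eq_bigr => ? _ do rewrite mxE.
Qed.

Lemma leq_vsum (m : nat) (r : 'I_m -> nat) i : (r i <= vsum r)%N.
Proof. by rewrite /vsum (bigD1 i) //= leq_addr. Qed.

(** In the hypothesis x is already eliminated: its right-hand side times N! is the coefficient of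
    x^r in the N-th power of the form with coefficients \sum_j y_j z_ij. The column recursion starts
    from q = 1. *)
Lemma ctpoly_capacity (R : rcfType) (m n N : nat) (r : 'I_m -> nat) (c : 'I_n -> nat)
    (Z : 'M[R]_(m, n)) (K : R) :
  vsum r = N -> vsum c = N -> (forall i j, 0 < Z i j) -> (forall j, (0 < c j)%N) ->
  (forall y : 'I_n -> R, (forall j, 0 < y j) ->
    K * \prod_j y j ^+ c j <= \prod_i ((\sum_j y j * Z i j) ^+ r i / (r i)`!%:R)) ->
  K * \prod_j ((c j ^ c j)%:R / (c j)`!%:R) <= (N ^ N)%:R / N`!%:R * ctpoly N r c Z.
Proof.
move=> rN cN Z0 c0 hK.
have f0 d : 0 < (d`!)%:R :> R by rewrite ltr0n fact_gt0.
have cs j : (c j <= N)%N by rewrite -cN leq_vsum.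
have := posprod_capacity Z0 c0 (index_enum_uniq _) (posprod_nil R m) (esym rN)
          (esym cN) (K := N`!%:R * K).
rewrite mulr1 (mcoeff_prod_lin Z r cs) -/(ctpoly N r c Z) => h.
have {}h := h _; rewrite big_split /= prodfV -natr_prod mulrA ler_pdivrMr ?prodr_gt0 //.
rewrite -(ler_pM2l (f0 N)) mulrA; apply: le_trans (h _) _ => [y y0|].
  by rewrite mulr1 (mcoeff_lin_pow _ rN) -mulrA ler_pM2l // hK.
apply: eq_ler.
by field; rewrite gt_eqF.
Qed.

(** * Weighted AM-GM, upper bounds and joint log-concavity of the table polynomial *)

Lemma exists_pos_weight (R : numDomainType) (p : nat) (alpha : 'I_p -> R) :
  (forall k, 0 <= alpha k) -> \sum_k alpha k = 1 -> exists k, 0 < alpha k.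
Proof.
move=> al0 al1; have /existsP[k ak] : [exists k, alpha k != 0].
  apply: contra_eqT al1 => /existsPn h; rewrite big1 1?eq_sym ?oner_neq0 // => k _.
  by apply/eqP; have := h k; rewrite negbK.
by exists k; rewrite lt_neqAle eq_sym ak al0.
Qed.

Lemma convex_comb_gt0 (R : numDomainType) (p : nat) (alpha x : 'I_p -> R) :
  (forall k, 0 <= alpha k) -> \sum_k alpha k = 1 -> (forall k, 0 < x k) ->
  0 < \sum_k alpha k * x k.
Proof.
move=> al0 al1 x0; have [k ak] := exists_pos_weight al0 al1.
rewrite (bigD1 k) //=; apply: ltr_pwDl; first exact: mulr_gt0.
by apply: sumr_ge0 => i _; rewrite mulr_ge0 // ltW.
Qed.

(** With A the weighted mean, a_k <= A exp(a_k / A - 1). Raised to the powers alpha_k and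
    multiplied, the exponential factors cancel. *)
Lemma weighted_AMGM (R : realType) (p : nat) (alpha a : 'I_p -> R) :
  (forall k, 0 <= alpha k) -> \sum_k alpha k = 1 -> (forall k, 0 <= a k) ->
  \prod_k powR (a k) (alpha k) <= \sum_k alpha k * a k.
Proof.
move=> al0 al1 a0; set A := \sum_k _.
have A0 : 0 <= A by apply: sumr_ge0 => k _; rewrite mulr_ge0.
(* Since [powR 0 0] is 1, the vanishing factor must come from an index of positive weight. *)
have [A_eq0|A_neq0] := eqVneq A 0.
  have [k ak] := exists_pos_weight al0 al1.
  have : alpha k * a k == 0.
    move/eqP: A_eq0; rewrite psumr_eq0 => [|k' _]; last by rewrite mulr_ge0.
    by move/allP => /(_ k (mem_index_enum _)) /implyP; apply.
  rewrite mulf_eq0 gt_eqF //= => /eqP ak0.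
  by rewrite (bigD1 k) //= ak0 powR0 ?mul0r // gt_eqF.
have {A_neq0}A0 : 0 < A by rewrite lt_neqAle eq_sym A_neq0.
apply: le_trans (_ : \prod_k (powR A (alpha k) * expR (alpha k * (a k / A - 1))) <= _).
  apply: ler_prod => k _; rewrite powR_ge0 /=.
  have [->|alk] := eqVneq (alpha k) 0; first by rewrite !powRr0 mul0r expR0 mulr1.
  have [->|ak] := eqVneq (a k) 0.
    by rewrite powR0 // mulr_ge0 ?powR_ge0 ?expR_ge0.
  have aA : 0 < a k / A by rewrite divr_gt0 // lt_neqAle eq_sym ak a0.
  rewrite -{1}(divfK (lt0r_neq0 A0) (a k)) (powRM _ (ltW aA) (ltW A0)).
  rewrite [leLHS]mulrC ler_pM2l ?powR_gt0 //.
  rewrite /powR gt_eqF // ler_expR ler_wpM2l //.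
  have := @le_ln1Dx R (a k / A - 1); rewrite addrCA subrr addr0; apply.
  by rewrite ltrBrDl subrr.
rewrite big_split /= -expR_sum.
have -> : \sum_k alpha k * (a k / A - 1) = 0.
  under eq_bigr => k _ do rewrite mulrBr mulr1 mulrA.
  by rewrite sumrB -mulr_suml -/A al1 divff ?subrr // gt_eqF.
rewrite expR0 mulr1.
have -> : \prod_k powR A (alpha k) = powR A (\sum_k alpha k).
  by rewrite /powR gt_eqF // mulr_suml expR_sum.
by rewrite al1 powRr1 // ltW.
Qed.

Lemma omega_gt0 (R : realType) (l : nat) (B : 'I_l -> nat) : 0 < omega R B.
Proof.
apply: prodr_gt0 => i _; rewrite divr_gt0 ?ltr0n ?fact_gt0 // expn_gt0.
by case: (B i).
Qed.

(** AM-GM for the numbers S_j / c_j with weights c_j / N. *)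
Lemma monomial_le_linear_pow (R : realType) (n N : nat) (c : 'I_n -> nat) (S : 'I_n -> R) :
  vsum c = N -> (forall j, 0 <= S j) -> (forall j, (0 < c j)%N) ->
  \prod_j (S j / (c j)%:R) ^+ c j <= ((\sum_j S j) / N%:R) ^+ N.
Proof.
move=> cN S0 c0; have [N0|Npos] := posnP N.
  rewrite N0 expr0 big1 // => j _.
  by have := leq_vsum c j; rewrite cN N0 leqn0 => /eqP ->.
have N_gt0 : 0 < N%:R :> R by rewrite ltr0n.
have cpos j : 0 < (c j)%:R :> R by rewrite ltr0n.
have a0 j : 0 <= S j / (c j)%:R by rewrite divr_ge0 ?ler0n.
have := @weighted_AMGM R n (fun j => (c j)%:R / N%:R) _ _ _ a0.
rewrite -mulr_suml -natr_sum -/(vsum c) cN divff ?gt_eqF // => h.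
have {}h := h (fun j => divr_ge0 (ler0n _ _) (ler0n _ _)) erefl.
have -> : \prod_j (S j / (c j)%:R) ^+ c j =
    (\prod_j powR (S j / (c j)%:R) ((c j)%:R / N%:R)) ^+ N.
  rewrite -prodrXl; apply: eq_bigr => j _.
  by rewrite -[RHS]powR_mulrn ?powR_ge0 // -powRrM divfK ?gt_eqF // powR_mulrn.
rewrite lerXn2r ?nnegrE //.
- by apply: prodr_ge0 => j _; apply: powR_ge0.
- by rewrite divr_ge0 ?ler0n // sumr_ge0.
apply: le_trans h _; rewrite mulr_suml ler_sum // => j _.
apply: eq_ler.
by field; rewrite !gt_eqF.
Qed.

(** Dropping the row condition enlarges the sum, which then factors into the column powers (\sum_i
    x_i y_j z_ij)^c_j / c_j!; AM-GM over the columns bounds their product. *)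
Lemma ctpoly_le_col (R : realType) (m n N : nat) (r : 'I_m -> nat) (c : 'I_n -> nat)
    (Z : 'M[R]_(m, n)) (x : 'I_m -> R) (y : 'I_n -> R) :
  vsum c = N -> (forall j, (0 < c j)%N) -> (forall i j, 0 <= Z i j) ->
  (forall i, 0 <= x i) -> (forall j, 0 <= y j) ->
  ctpoly N r c Z * (\prod_i x i ^+ r i * \prod_j y j ^+ c j)
    <= omega R c * ((\sum_i \sum_j x i * y j * Z i j) / N%:R) ^+ N.
Proof.
move=> cN c0 Z0 x0 y0.
have cs j : (c j <= N)%N by rewrite -cN leq_vsum.
have f0 d : 0 < (d`!)%:R :> R by rewrite ltr0n fact_gt0.
pose u d : R := (d`!)%:R^-1.
have u1 d : u d * (d`!)%:R = 1 by rewrite mulVf // gt_eqF.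
pose a i j := x i * y j * Z i j.
have a0 i j : 0 <= a i j by rewrite !mulr_ge0.
have := monomial_le_linear_pow cN (fun j => sumr_ge0 _ (fun i _ => a0 i j)) c0.
rewrite exchange_big /= => h.
apply: le_trans (_ : omega R c * \prod_j ((\sum_i a i j) / (c j)%:R) ^+ c j <= _); last first.
  by rewrite ler_pM2l ?omega_gt0.
have -> : omega R c * \prod_j ((\sum_i a i j) / (c j)%:R) ^+ c j =
    \prod_j (u (c j) * (\sum_i a i j) ^+ c j).
  rewrite /omega -big_split /=; apply: eq_bigr => j _.
  rewrite expr_div_n natrX /u; field.
  by rewrite !gt_eqF ?exprn_gt0 ?ltr0n ?fact_gt0.
rewrite (prod_multinomial_divided a u1 cs) /ctpoly mulr_suml.
rewrite [leRHS](bigID (fun D : 'M['I_N.+1]_(m, n) => is_table r c D)) /=.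
apply: ler_wpDr.
  apply: sumr_ge0 => D _; do 2!apply: prodr_ge0 => ? _.
  by rewrite mulr_ge0 ?exprn_ge0 // invr_ge0 ler0n.
apply: eq_ler.
apply: eq_big => [D|D /andP[/forallP hr /forallP hc]].
  by rewrite /is_table andbCA andbb.
have -> : \prod_i x i ^+ r i = \prod_i \prod_j x i ^+ D i j.
  by apply: eq_bigr => i _; rewrite -expr_sum (eqP (hr i)).
have -> : \prod_j y j ^+ c j = \prod_i \prod_j y j ^+ D i j.
  by rewrite exchange_big; apply: eq_bigr => j _; rewrite -expr_sum (eqP (hc j)).
rewrite -!big_split; apply: eq_bigr => i _; rewrite -!big_split; apply: eq_bigr => j _ /=.
rewrite /a /u !exprMn; ring.
Qed.

(** The bound with [omega R r] is the column bound for the transpose. *)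
Lemma ctpoly_le (R : realType) (m n N : nat) (r : 'I_m -> nat) (c : 'I_n -> nat)
    (Z : 'M[R]_(m, n)) (x : 'I_m -> R) (y : 'I_n -> R) :
  vsum r = N -> vsum c = N -> (forall i, (0 < r i)%N) -> (forall j, (0 < c j)%N) ->
  (forall i j, 0 <= Z i j) -> (forall i, 0 <= x i) -> (forall j, 0 <= y j) ->
  ctpoly N r c Z * (\prod_i x i ^+ r i * \prod_j y j ^+ c j)
    <= Num.min (omega R r) (omega R c)
       * ((\sum_i \sum_j x i * y j * Z i j) / N%:R) ^+ N.
Proof.
move=> rN cN r0 c0 Z0 x0 y0; rewrite /Order.min; case: ifP => _; last exact: ctpoly_le_col.
have Zt0 i j : 0 <= Z^T i j by rewrite mxE.
have := ctpoly_le_col c rN r0 Zt0 y0 x0.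
rewrite ctpoly_tr [X in _ * X]mulrC => /le_trans; apply.
apply: eq_ler; congr (_ * (_ / _) ^+ _).
rewrite exchange_big.
apply: eq_bigr => i _; apply: eq_bigr => j _.
by rewrite mxE [y j * x i]mulrC.
Qed.

(** The geometric mean of the upper bounds for the single k bounds the capacity of the averaged data
    from below; Gurvits's inequality converts this into a lower bound for P at the averages. *)
Lemma ctpoly_logconcave (R : realType) (m n p N : nat) (Z : 'I_p -> 'M[R]_(m, n))
    (Rk : 'I_p -> 'I_m -> nat) (Ck : 'I_p -> 'I_n -> nat) (alpha : 'I_p -> R)
    (Rv : 'I_m -> nat) (Cv : 'I_n -> nat) :
  (forall k i j, 0 < Z k i j) ->
  (forall k i, (0 < Rk k i)%N) -> (forall k j, (0 < Ck k j)%N) ->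
  (forall k, vsum (Rk k) = N) -> (forall k, vsum (Ck k) = N) ->
  (forall k, 0 <= alpha k) -> \sum_(k < p) alpha k = 1 ->
  (forall i, (Rv i)%:R = \sum_(k < p) alpha k * (Rk k i)%:R) ->
  (forall j, (Cv j)%:R = \sum_(k < p) alpha k * (Ck k j)%:R) ->
  (forall i, (0 < Rv i)%N) -> (forall j, (0 < Cv j)%N) ->
  vsum Rv = N -> vsum Cv = N ->
  \prod_(k < p) powR (ctpoly N (Rk k) (Ck k) (Z k)
                      / Num.min (omega R (Rk k)) (omega R (Ck k))) (alpha k)
  <= (N ^ N)%:R / N`!%:R / (omega R Rv * omega R Cv)
     * ctpoly N Rv Cv (\sum_k alpha k *: Z k).
Proof.
move=> Z0 Rk0 Ck0 RkN CkN al0 al1 RvE CvE Rv0 Cv0 RvN CvN.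
set L := \prod_(k < p) _; set Zs := \sum_k _.
have ZsE i j : Zs i j = \sum_k alpha k * Z k i j.
  by rewrite summxE; apply: eq_bigr => k _; rewrite mxE.
have Zs0 i j : 0 < Zs i j by rewrite ZsE; apply: convex_comb_gt0.
have main (x : 'I_m -> R) (y : 'I_n -> R) : (forall i, 0 < x i) -> (forall j, 0 < y j) ->
    L * (\prod_i x i ^+ Rv i * \prod_j y j ^+ Cv j)
    <= ((\sum_i \sum_j x i * y j * Zs i j) / N%:R) ^+ N.
  move=> x0 y0.
  pose S k := (\sum_i \sum_j x i * y j * Z k i j) / N%:R.
  have S0 k : 0 <= S k.
    rewrite divr_ge0 ?ler0n //; apply: sumr_ge0 => i _; apply: sumr_ge0 => j _.
    by rewrite !mulr_ge0 // ltW.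
  (* The logarithm of a monomial is linear in its exponents, so averaged margins give a weighted
     geometric mean. *)
  have mon_powR (l : nat) (w : 'I_l -> R) (B : 'I_l -> nat) (Bk : 'I_p -> 'I_l -> nat) :
      (forall i, 0 < w i) -> (forall i, (B i)%:R = \sum_(k < p) alpha k * (Bk k i)%:R) ->
      \prod_i w i ^+ B i = \prod_k powR (\prod_i w i ^+ Bk k i) (alpha k).
    move=> w0 BE.
    have -> : \prod_i w i ^+ B i = expR (\sum_i (B i)%:R * ln (w i)).
      rewrite expR_sum; apply: eq_bigr => i _.
      by rewrite -powR_mulrn ?ltW // /powR gt_eqF.
    have -> : \prod_k powR (\prod_i w i ^+ Bk k i) (alpha k)
        = \prod_k expR (\sum_i alpha k * (Bk k i)%:R * ln (w i)).
      apply: eq_bigr => k _.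
      have -> : \prod_i w i ^+ Bk k i = expR (\sum_i (Bk k i)%:R * ln (w i)).
        rewrite expR_sum; apply: eq_bigr => i _.
        by rewrite -powR_mulrn ?ltW // /powR gt_eqF.
      rewrite /powR gt_eqF ?expR_gt0 // expRK mulr_sumr.
      by congr expR; apply: eq_bigr => i _; rewrite mulrA.
    rewrite -expR_sum; congr expR; rewrite exchange_big; apply: eq_bigr => i _ /=.
    by rewrite BE mulr_suml.
  rewrite (mon_powR _ x _ _ x0 RvE) (mon_powR _ y _ _ y0 CvE) -!big_split /=.
  apply: le_trans (_ : \prod_k powR (S k ^+ N) (alpha k) <= _).
    apply: ler_prod => k _.
    have pgt0 : 0 < Num.min (omega R (Rk k)) (omega R (Ck k)).
      by rewrite lt_min !omega_gt0.
    have ct0 : 0 <= ctpoly N (Rk k) (Ck k) (Z k) by apply: ctpoly_ge0 => i j; apply: ltW.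
    have px (l : nat) (w : 'I_l -> R) (B : 'I_l -> nat) : (forall i, 0 < w i) ->
        0 <= \prod_i w i ^+ B i.
      by move=> w0; apply: prodr_ge0 => i _; rewrite exprn_ge0 // ltW.
    have [X0 Y0] := (px _ x (Rk k) x0, px _ y (Ck k) y0).
    have t0 := divr_ge0 ct0 (ltW pgt0).
    rewrite !mulr_ge0 ?powR_ge0 //= -(powRM _ X0 Y0) -(powRM _ t0 (mulr_ge0 X0 Y0)).
    apply: ge0_ler_powR; rewrite ?nnegrE ?exprn_ge0 //.
      exact: mulr_ge0 t0 (mulr_ge0 X0 Y0).
    rewrite mulrAC ler_pdivrMr // [leRHS]mulrC.
    by apply: ctpoly_le => // [i j|i|j]; apply: ltW.
  have -> : \prod_k powR (S k ^+ N) (alpha k) = (\prod_k powR (S k) (alpha k)) ^+ N.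
    rewrite -prodrXl; apply: eq_bigr => k _.
    by rewrite -[RHS]powR_mulrn ?powR_ge0 // powRAC powR_mulrn.
  (* The total weight is linear in Z, which reduces the claim to AM-GM for the [S k]. *)
  have -> : (\sum_i \sum_j x i * y j * Zs i j) / N%:R = \sum_k alpha k * S k.
    under [RHS]eq_bigr => k _ do rewrite /S mulrA.
    rewrite -mulr_suml; congr (_ / _).
    under [RHS]eq_bigr => k _ do rewrite mulr_sumr.
    rewrite [RHS]exchange_big; apply: eq_bigr => i _ /=.
    under [RHS]eq_bigr => k _ do rewrite mulr_sumr.
    rewrite [RHS]exchange_big; apply: eq_bigr => j _ /=.
    by rewrite ZsE mulr_sumr; apply: eq_bigr => k _; rewrite mulrCA.
  rewrite lerXn2r ?nnegrE ?weighted_AMGM //.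
  - by apply: prodr_ge0 => k _; apply: powR_ge0.
  - by apply: sumr_ge0 => k _; rewrite mulr_ge0.
have := @ctpoly_capacity R m n N Rv Cv Zs (omega R Rv * L) RvN CvN Zs0 Cv0.
rewrite -/(omega R Cv) => h.
have om0 : 0 < omega R Rv * omega R Cv by rewrite mulr_gt0 ?omega_gt0.
rewrite mulrAC ler_pdivlMr // mulrA [L * _]mulrC; apply: h => y y0.
pose s i := \sum_j y j * Zs i j.
have s0 i : 0 < s i.
  have : (0 < vsum Cv)%N by rewrite CvN -RvN (leq_trans (Rv0 i)) // leq_vsum.
  case: (posnP n) => [n0|npos _]; first by subst n; rewrite /vsum big_ord0.
  rewrite /s (bigD1 (Ordinal npos)) //= ltr_pwDl ?mulr_gt0 //.
  by apply: sumr_ge0 => j _; rewrite mulr_ge0 // ltW.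
(* This choice of x makes the total weight \sum_ij x_i y_j z_ij equal to N. *)
pose x i := (Rv i)%:R / s i.
have x0 i : 0 < x i by rewrite divr_gt0 ?ltr0n.
have := main x y x0 y0.
have -> : \sum_i \sum_j x i * y j * Zs i j = N%:R.
  rewrite -RvN /vsum natr_sum; apply: eq_bigr => i _.
  under eq_bigr => j _ do rewrite -mulrA.
  by rewrite -mulr_sumr -/(s i) divfK ?gt_eqF.
have -> : (N%:R / N%:R : R) ^+ N = 1.
  by case: (posnP N) => [->|Np]; rewrite ?expr0 // divff ?expr1n // pnatr_eq0 -lt0n.
have px : 0 < \prod_i x i ^+ Rv i by apply: prodr_gt0 => i _; rewrite exprn_gt0.
rewrite mulrCA mulrC -ler_pdivlMr // => /(ler_wpM2l (ltW (omega_gt0 R Rv))).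
rewrite mulrA => /le_trans; apply; rewrite /omega div1r -prodfV -big_split /=.
apply: eq_ler; apply: eq_bigr => i _.
rewrite /x -/(s i) natrX expr_div_n invf_div; field.
by rewrite !gt_eqF ?exprn_gt0 ?ltr0n ?fact_gt0.
Qed.

(** * A Prekopa-Leindler inequality for polynomials *)

Lemma is_derive_wsum (R : realType) (I : Type) (s : seq I) (b : I -> R) (f : I -> R -> R)
    (df : I -> R) (x : R) :
  (forall i, is_derive x 1 (f i) (df i)) ->
  is_derive x 1 (fun t => \sum_(i <- s) b i * f i t) (\sum_(i <- s) b i * df i).
Proof.
move=> hf; elim: s => [|i s IH].
  under eq_fun => t do rewrite big_nil.
  rewrite big_nil; exact: is_derive_cst.
under eq_fun => t do rewrite big_cons.
rewrite big_cons; apply: is_deriveD; exact: is_deriveZ.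
Qed.

(** [expR (- t) * exp_tail d t] is the incomplete gamma integral of s^d e^(-s) over s >= t; the
    recursion is integration by parts. *)
Fixpoint exp_tail (R : nzSemiRingType) (d : nat) (t : R) : R :=
  if d is d'.+1 then t ^+ d + d%:R * exp_tail d' t else 1.

Lemma exp_tail0 (R : nzSemiRingType) (d : nat) : exp_tail d 0 = d`!%:R :> R.
Proof.
elim: d => [|d IH] //=.
by rewrite expr0n add0r IH factS natrM.
Qed.

Lemma is_derive_exp_tail (R : realType) (d : nat) (x : R) :
  is_derive x 1 (fun t => expR (- t) * exp_tail d t) (- (expR (- x) * x ^+ d)).
Proof.
have hE : is_derive x 1 (fun t => expR (- t)) (- expR (- x)).
  have h := is_derive1_comp (is_derive_expR (- x)) (is_deriveNid x 1).
  by rewrite mulrN1 in h; exact: h.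
elim: d => [|d IH] /=.
  under eq_fun => t do rewrite mulr1.
  by rewrite expr0 mulr1.
under eq_fun => t do rewrite mulrDr mulrCA.
have hX : is_derive x 1 (fun t : R => t ^+ d.+1) (d.+1%:R * x ^+ d).
  have h := is_deriveX d.+1 (is_derive_id x (1 : R)).
  rewrite exprfctE in h.
  by apply: is_derive_eq h _; rewrite /GRing.scale /= mulr1.
have h := is_deriveD (is_deriveM hE hX) (is_deriveZ d.+1%:R IH).
apply: is_derive_eq h _; rewrite /GRing.scale /=; ring.
Qed.

Lemma is_derive_continuous (R : realType) (f : R -> R) (x df : R) :
  is_derive x 1 f df -> {for x, continuous f}.
Proof.
by move=> h; apply/differentiable_continuous/derivable1_diffP; apply: ex_derive.
Qed.

Lemma is_derive_within (R : realType) (f df : R -> R) (a b : R) :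
  (forall x, x \in `[a, b] -> is_derive x 1 f (df x)) ->
  {within [set` `[a, b]], continuous f}.
Proof.
move=> h; apply: continuous_in_subspaceT => x xab.
by apply: is_derive_continuous; apply: h; rewrite inE in xab.
Qed.

Lemma is_derive_MVT (R : realType) (f df : R -> R) (a b : R) :
  a < b -> (forall x, x \in `[a, b] -> is_derive x 1 f (df x)) ->
  exists2 x, x \in `]a, b[ & f b - f a = df x * (b - a).
Proof.
move=> ab h.
have hc := is_derive_within h.
have ho x : x \in `]a, b[ -> is_derive x 1 f (df x).
  by move=> /subset_itv_oo_cc; apply: h.
exact: MVT ab ho hc.
Qed.

(* The decreasing rearrangement x_k(u) carries the measure with density f_k to the uniform
   measure on [0, A_k]; AM-GM bounds below the speed of u |-> H (\sum_k alpha_k x_k(u)). *)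
Lemma transport_ineq (R : realType) (p : nat) (alpha : 'I_p -> R)
    (f F : 'I_p -> R -> R) (h H : R -> R) :
  (forall k, 0 <= alpha k) -> \sum_k alpha k = 1 ->
  (forall k (x : R), is_derive x 1 (F k) (- f k x)) ->
  (forall k (x : R), 0 < x -> 0 < f k x) -> (forall k (x : R), 0 < x -> 0 <= F k x) ->
  (forall k (e : R), 0 < e -> exists2 b, 0 < b & F k b <= e) ->
  (forall x : R, is_derive x 1 H (- h x)) -> (forall x : R, 0 < x -> 0 <= H x) ->
  (forall x : 'I_p -> R, (forall k, 0 < x k) ->
    \prod_k powR (f k (x k)) (alpha k) <= h (\sum_k alpha k * x k)) ->
  \prod_k powR (F k 0) (alpha k) <= H 0.
Proof.
move=> al0 al1 dF f0 F0 Finf dH H0 hf.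
have F_lt k x y : 0 <= x -> x < y -> F k y < F k x.
  move=> x0 xy; have [z zxy E] := is_derive_MVT xy (fun z _ => dF k z).
  rewrite -subr_lt0 E mulNr oppr_lt0 mulr_gt0 ?subr_gt0 // f0 //.
  by move: zxy; rewrite in_itv /= => /andP[xz _]; apply: le_lt_trans xz.
have Fpos k x : 0 <= x -> 0 < F k x.
  move=> x0; apply: le_lt_trans (F_lt k x (x + 1) x0 _); last by rewrite ltrDl.
  by apply: F0; rewrite ltr_wpDl.
have A0 k : 0 < F k 0 by apply: Fpos.
have Finj k x y : 0 <= x -> 0 <= y -> F k x = F k y -> x = y.
  move=> x0 y0 E; case: (ltgtP x y) => // /(F_lt k _ _); rewrite E ltxx => h0.
    by have := h0 x0.
  by have := h0 y0.
(* The condition on u sits inside the existential so that choice yields a total function; its value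
   0 outside the open unit interval is arbitrary. *)
have invF k u : exists x, 0 < u < 1 -> 0 < x /\ F k x = u * F k 0.
  case: (boolP (0 < u < 1)) => [/andP[u0 u1]|_]; last by exists 0.
  have uA0 : 0 < u * F k 0 by rewrite mulr_gt0.
  have uA1 : u * F k 0 < F k 0 by rewrite gtr_pMl.
  have [b b0 Fb] := Finf k _ uA0.
  have Fcont : {within [set` `[0, b]], continuous (F k)}.
    by apply: is_derive_within => x _; apply: dF.
  have [|x xb Fx] := @IVT R (F k) 0 b (u * F k 0) (ltW b0) Fcont.
    by rewrite ge_min le_max Fb (ltW uA1) orbT.
  exists x => _; split => //; move: xb; rewrite in_itv /= => /andP[x0 _].
  rewrite lt_neqAle x0 andbT; apply: contraTneq uA1 => x0'.
  by rewrite -Fx -x0' ltxx.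
have invF' k : exists G : R -> R, forall u, 0 < u < 1 -> 0 < G u /\ F k (G u) = u * F k 0.
  by have [G hG] := choice (invF k); exists G.
have [G hG] := choice invF'.
have G0 k u : 0 < u < 1 -> 0 < G k u by move=> u01; case: (hG k u u01).
have GE k u : 0 < u < 1 -> F k (G k u) = u * F k 0 by move=> u01; case: (hG k u u01).
have dG k (u : R) : 0 < u < 1 -> is_derive u 1 (G k) (- (F k 0 / f k (G k u))).
  move=> u01; have x0 := G0 k u u01.
  pose fk x := (F k 0)^-1 * F k x.
  have dfk (x : R) : is_derive x 1 fk ((F k 0)^-1 * - f k x) by apply: is_deriveZ.
  have fkx : fk (G k u) = u by rewrite /fk GE // mulrCA mulVf ?mulr1 // gt_eqF.
  have canc : {near G k u, cancel fk (G k)}.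
    near=> y; have y0 : 0 < y by near: y; apply: lt_nbhsr.
    have fky : 0 < fk y < 1.
      apply/andP; split; last by rewrite ltr_pdivrMl // mulr1; apply: F_lt.
      by apply: mulr_gt0; [rewrite invr_gt0 | apply/Fpos/ltW].
    apply: (@Finj k); [exact/ltW/G0 | exact: ltW |].
    by rewrite GE // /fk mulrAC mulVf ?mul1r // gt_eqF.
  have cont : {near G k u, continuous fk}.
    by near=> y; apply: is_derive_continuous (dfk _).
  have fx0 := f0 k _ x0.
  have := is_derive_inverse canc cont (dfk (G k u)) _; rewrite fkx => hd.
  apply: is_derive_eq; first apply: hd.
    by rewrite mulf_neq0 ?invr_eq0 ?oppr_eq0 ?gt_eqF.
  by field; rewrite !gt_eqF.
pose x u := \sum_k alpha k * G k u.
have x_gt0 u : 0 < u < 1 -> 0 < x u.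
  by move=> u01; apply: convex_comb_gt0 => // k; apply: G0.
pose K := \prod_k powR (F k 0) (alpha k).
pose dPhi u := - h (x u) * \sum_k alpha k * - (F k 0 / f k (G k u)).
have dPhiE (u : R) : 0 < u < 1 -> is_derive u 1 (H \o x) (dPhi u).
  by move=> u01; apply: is_derive1_comp; apply: is_derive_wsum => k; apply: dG.
(* The densities cancel: h is at least \prod f_k^alpha_k by hypothesis, and the average of F_k(0) /
   f_k is at least its geometric mean. *)
have K_le u : 0 < u < 1 -> K <= dPhi u.
  move=> u01; rewrite /dPhi mulNr.
  under eq_bigr => k _ do rewrite mulrN.
  rewrite sumrN mulrN opprK.
  have fG k : 0 < f k (G k u) by rewrite f0 ?G0.
  apply: le_trans (_ : \prod_k powR (f k (G k u)) (alpha k)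
                       * \prod_k powR (F k 0 / f k (G k u)) (alpha k) <= _).
    rewrite -big_split /=; apply: eq_ler; apply: eq_bigr => k _.
    rewrite -powRM ?(ltW (fG k)) //; last by rewrite divr_ge0 // ltW.
    by rewrite mulrC divfK // gt_eqF.
  apply: ler_pM.
  - by apply: prodr_ge0 => k _; apply: powR_ge0.
  - by apply: prodr_ge0 => k _; apply: powR_ge0.
  - by apply: hf => k; apply: G0.
  - by apply: weighted_AMGM => // k; rewrite divr_ge0 // ltW.
have Hx_le u : 0 < u < 1 -> H (x u) <= H 0.
  move=> u01; have [z zx E] := is_derive_MVT (x_gt0 u u01) (fun z _ => dH z).
  rewrite -subr_le0 E subr0 mulNr oppr_le0 mulr_ge0 ?(ltW (x_gt0 u u01)) //.
  move: zx; rewrite in_itv /= => /andP[z0 _].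
  have := hf (fun=> z) (fun=> z0); rewrite -mulr_suml al1 mul1r; apply: le_trans.
  by apply: prodr_ge0 => k _; apply: powR_ge0.
have K_gt0 : 0 < K by apply: prodr_gt0 => k _; apply: powR_gt0.
(* The inverses are controlled only inside (0, 1), so the mean value theorem is used on [e, 1 - e],
   where H o x grows by at most H(0). *)
have step e : 0 < e -> e < 2^-1 -> K * (1 - 2 * e) <= H 0.
  move=> e0 e1.
  have ab : e < 1 - e by lra.
  have in01 u : u \in `[e, 1 - e] -> 0 < u < 1.
    by rewrite in_itv /= => /andP[u1 u2]; apply/andP; split; lra.
  have [u uab E] := is_derive_MVT ab (fun u uab => dPhiE u (in01 u uab)).
  have u01 : 0 < u < 1 by apply/in01/subset_itv_oo_cc.
  have e01 : 0 < e < 1 by apply/andP; split; lra.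
  have e02 : 0 < 1 - e < 1 by apply/andP; split; lra.
  have h1 := Hx_le _ e02; have h2 := H0 _ (x_gt0 _ e01).
  have h3 : K * (1 - e - e) <= dPhi u * (1 - e - e).
    by rewrite ler_pM2r ?K_le //; lra.
  move: E h1 h2 h3; rewrite /=; move: (H (x (1 - e))) (H (x e)) => a b.
  by move=> E h1 h2 h3; rewrite -E in h3; lra.
rewrite leNgt; apply/negP => lt; rewrite -/K in lt.
(* This e makes K (1 - 2 e) the midpoint of K and H(0), which would exceed H(0). *)
have := step ((K - H 0) / (4 * K)).
have -> : K * (1 - 2 * ((K - H 0) / (4 * K))) = (K + H 0) / 2 by field; rewrite gt_eqF.
have H00 : 0 <= H 0.
  have u01 : 0 < (2^-1 : R) < 1 by apply/andP; split; lra.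
  by apply: le_trans (Hx_le _ u01); apply/H0/x_gt0.
have q0 : 0 < (K - H 0) / (4 * K) by rewrite divr_gt0 ?mulr_gt0 // ?subr_gt0.
have q1 : (K - H 0) / (4 * K) < 2^-1 by rewrite ltr_pdivrMr ?mulr_gt0 //; lra.
by move=> /(_ q0 q1); lra.
Unshelve. all: by end_near.
Qed.

(** * Integration against the exponential distribution *)

Lemma powR_expR (R : realType) (x a : R) : powR (expR x) a = expR (a * x).
Proof. by rewrite /powR gt_eqF ?expR_gt0 // expRK. Qed.

(** The exponent x / 2 leaves a decay e^(-x/2) after multiplication by e^(-x), so the tail integrals
    become arbitrarily small. *)
Lemma exp_tail_le (R : realType) (d : nat) :
  exists2 C : R, 0 < C & forall x, 0 <= x -> exp_tail d x <= C * expR (x / 2).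
Proof.
elim: d => [|d [C C0 IH]] /=.
  exists 1 => // x x0; rewrite mul1r; apply: le_trans (expR_ge1Dx _).
  by rewrite lerDl divr_ge0.
(* This D gives (e^(x/D))^(d+1) = e^(x/2), and x / D <= e^(x/D). *)
pose D : R := 2 * d.+1%:R.
have D0 : 0 < D by rewrite mulr_gt0 ?ltr0n.
exists (D ^+ d.+1 + d.+1%:R * C) => [|x x0].
  by rewrite addr_gt0 ?exprn_gt0 ?mulr_gt0 ?ltr0n.
rewrite mulrDl -mulrA lerD //; last by rewrite ler_wpM2l ?IH ?ler0n.
have -> : expR (x / 2) = expR (x / D) ^+ d.+1.
  by rewrite -expRM_natl; congr expR; rewrite /D; field; rewrite ?nat1r ?natr1 pnatr_eq0.
rewrite -exprMn lerXn2r ?nnegrE ?mulr_ge0 ?(ltW D0) ?expR_ge0 //.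
rewrite -ler_pdivrMl //; apply: le_trans (expR_ge1Dx _).
by rewrite mulrC lerDr.
Qed.

(** Transport applies to the densities e^(-x) \sum_j b_j x^d_j, of total mass \sum_j b_j d_j!. The
    geometric mean of the e^(-x_k) is e^(-x) at the averaged point, so the pointwise hypothesis
    needs only the polynomials. *)
Lemma prekopa_leindler_exp1 (R : realType) (p : nat) (J : finType) (alpha : 'I_p -> R)
    (b : 'I_p -> J -> R) (bh : J -> R) (d : J -> nat) :
  (forall k, 0 <= alpha k) -> \sum_k alpha k = 1 ->
  (forall k j, 0 <= b k j) -> (forall k, exists j, 0 < b k j) -> (forall j, 0 <= bh j) ->
  (forall x : 'I_p -> R, (forall k, 0 < x k) ->
    \prod_k powR (\sum_j b k j * x k ^+ d j) (alpha k)
      <= \sum_j bh j * (\sum_k alpha k * x k) ^+ d j) ->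
  \prod_k powR (\sum_j b k j * (d j)`!%:R) (alpha k) <= \sum_j bh j * (d j)`!%:R.
Proof.
move=> al0 al1 b0 bpos bh0 hyp.
pose F (c : J -> R) x := \sum_j c j * (expR (- x) * exp_tail (d j) x).
pose f (c : J -> R) x := \sum_j c j * (expR (- x) * x ^+ d j).
have F_0 c : F c 0 = \sum_j c j * (d j)`!%:R.
  by apply: eq_bigr => j _; rewrite oppr0 expR0 mul1r exp_tail0.
have fE c x : f c x = expR (- x) * \sum_j c j * x ^+ d j.
  by rewrite /f mulr_sumr; apply: eq_bigr => j _; rewrite mulrCA.
have dF c (x : R) : is_derive x 1 (F c) (- f c x).
  have := is_derive_wsum (index_enum J) c (fun j => is_derive_exp_tail (d j) x).
  move=> h; apply: is_derive_eq h _.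
  by rewrite /f -sumrN; apply: eq_bigr => j _; rewrite mulrN.
have tail_ge0 j (x : R) : 0 <= x -> 0 <= exp_tail (d j) x.
  move=> x0; elim: (d j) => [|i IH] //=.
  by rewrite addr_ge0 ?exprn_ge0 ?mulr_ge0 ?ler0n.
have F_ge0 c (x : R) : (forall j, 0 <= c j) -> 0 < x -> 0 <= F c x.
  move=> c0 x0; apply: sumr_ge0 => j _.
  by rewrite !mulr_ge0 ?expR_ge0 // tail_ge0 // ltW.
have F_small c (e : R) : (forall j, 0 <= c j) -> 0 < e -> exists2 B, 0 < B & F c B <= e.
  move=> c0 e0.
  have /choice[C hC] j :
      exists C : R, 0 < C /\ forall x, 0 <= x -> exp_tail (d j) x <= C * expR (x / 2).
    by have [C C0 hC] := exp_tail_le R (d j); exists C.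
  pose M := 1 + \sum_j c j * C j.
  have M0 : 0 < M.
    rewrite ltr_pwDl ?ltr01 //; apply: sumr_ge0 => j _.
    by rewrite mulr_ge0 // ltW //; case: (hC j).
  (* At this point e^(B/2) is at least M / e. *)
  exists (2 * (M / e)); first by rewrite mulr_gt0 ?divr_gt0.
  set B := 2 * _; have B0 : 0 <= B by rewrite mulr_ge0 ?divr_ge0 ?ltW.
  apply: le_trans (_ : M * expR (- (B / 2)) <= _).
    apply: le_trans (_ : (\sum_j c j * C j) * expR (- (B / 2)) <= _); last first.
      by rewrite ler_wpM2r ?expR_ge0 // lerDr ler01.
    rewrite mulr_suml ler_sum // => j _; rewrite -mulrA ler_wpM2l //.
    have -> : expR (- (B / 2)) = expR (- B) * expR (B / 2) by rewrite -expRD; congr expR; lra.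
    by rewrite mulrCA ler_wpM2l ?expR_ge0 //; case: (hC j) => _; apply.
  rewrite expRN ler_pdivrMr ?expR_gt0 //.
  have -> : B / 2 = M / e by rewrite /B; field; rewrite gt_eqF.
  rewrite -ler_pdivrMl // mulrC; apply: le_trans (expR_ge1Dx _).
  by rewrite lerDr.
rewrite -F_0; under eq_bigr => k _ do rewrite -F_0.
apply: (@transport_ineq R p alpha (fun k => f (b k)) (fun k => F (b k)) (f bh)) => //.
- move=> k x x0; rewrite fE mulr_gt0 ?expR_gt0 //.
  have [j bj] := bpos k; rewrite (bigD1 j) //=; apply: ltr_pwDl.
    by rewrite mulr_gt0 ?exprn_gt0.
  by apply: sumr_ge0 => i _; rewrite mulr_ge0 ?exprn_ge0 // ltW.
- by move=> k x; apply: F_ge0.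
- by move=> k e; apply: F_small.
- by move=> x; apply: F_ge0.
move=> x x0; under eq_bigr => k _ do rewrite fE.
rewrite fE; apply: le_trans (_ : expR (- \sum_k alpha k * x k) *
   \prod_k powR (\sum_j b k j * x k ^+ d j) (alpha k) <= _); last first.
  by rewrite ler_wpM2l ?expR_ge0 // hyp.
rewrite -sumrN expR_sum -big_split /=; apply: eq_ler.
apply: eq_bigr => k _; rewrite powRM ?expR_ge0 //; last first.
  by apply: sumr_ge0 => j _; rewrite mulr_ge0 ?exprn_ge0 // ltW.
by rewrite powR_expR mulrN.
Qed.

(** Coordinates are integrated out one at a time; [w S] is the monomial factor once the powers of
    the coordinates in [S] have become factorials. *)
Lemma prekopa_leindler_exp (R : realType) (p : nat) (J E : finType) (alpha : 'I_p -> R)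
    (b : 'I_p -> J -> R) (bh : J -> R) (d : J -> E -> nat) :
  (forall k, 0 <= alpha k) -> \sum_k alpha k = 1 ->
  (forall k j, 0 <= b k j) -> (forall k, exists j, 0 < b k j) -> (forall j, 0 <= bh j) ->
  (forall x : 'I_p -> E -> R, (forall k e, 0 < x k e) ->
    \prod_k powR (\sum_j b k j * \prod_e x k e ^+ d j e) (alpha k)
      <= \sum_j bh j * \prod_e (\sum_k alpha k * x k e) ^+ d j e) ->
  \prod_k powR (\sum_j b k j * \prod_e (d j e)`!%:R) (alpha k)
    <= \sum_j bh j * \prod_e (d j e)`!%:R.
Proof.
move=> al0 al1 b0 bpos bh0 hyp.
pose w (S : seq E) (x : E -> R) j e : R :=
  if e \in S then (d j e)`!%:R else x e ^+ d j e.
have w_gt0 S x j e : (forall e, 0 < x e) -> 0 < w S x j e.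
  by move=> x0; rewrite /w; case: ifP => _; rewrite ?ltr0n ?fact_gt0 ?exprn_gt0.
have claim S : forall x : 'I_p -> E -> R, (forall k e, 0 < x k e) ->
    \prod_k powR (\sum_j b k j * \prod_e w S (x k) j e) (alpha k)
      <= \sum_j bh j * \prod_e w S (fun e => \sum_k alpha k * x k e) j e.
  elim: S => [|e0 S IH] x x0; first by have := hyp x x0.
  case: (boolP (e0 \in S)) => e0S.
    have wE y j e : w (e0 :: S) y j e = w S y j e.
      by rewrite /w inE; case: eqP => // ->; rewrite e0S.
    under eq_bigr => k _ do under eq_bigr => j _ do under eq_bigr => e _ do rewrite wE.
    under [leRHS]eq_bigr => j _ do under eq_bigr => e _ do rewrite wE.
    exact: IH.
  pose xs e := \sum_k alpha k * x k e.
  have split_e0 (y : E -> R) j t :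
      \prod_e w S (fun e => if e == e0 then t else y e) j e
      = \prod_(e | e != e0) w S y j e * t ^+ d j e0.
    rewrite (bigD1 e0) //= mulrC {2}/w (negPf e0S) eqxx; congr (_ * _).
    by apply: eq_bigr => e ne; rewrite /w (negPf ne).
  have split_cons (y : E -> R) j :
      \prod_e w (e0 :: S) y j e = \prod_(e | e != e0) w S y j e * (d j e0)`!%:R.
    rewrite (bigD1 e0) //= mulrC {2}/w inE eqxx; congr (_ * _).
    by apply: eq_bigr => e ne; rewrite /w inE (negPf ne).
  have prod_gt0 y j : (forall e, 0 < y e) -> 0 < \prod_(e | e != e0) w S y j e.
    by move=> y0; apply: prodr_gt0 => e _; apply: w_gt0.
  have xs0 e : 0 < xs e by apply: convex_comb_gt0.
  have := @prekopa_leindler_exp1 R p J alpha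
    (fun k j => b k j * \prod_(e | e != e0) w S (x k) j e)
    (fun j => bh j * \prod_(e | e != e0) w S xs j e) (fun j => d j e0) al0 al1.
  move=> h.
  under eq_bigr => k _ do under eq_bigr => j _ do rewrite split_cons mulrA.
  under [leRHS]eq_bigr => j _ do rewrite split_cons mulrA.
  apply: h.
  - by move=> k j; rewrite mulr_ge0 // ltW // prod_gt0.
  - by move=> k; have [j bj] := bpos k; exists j; rewrite mulr_gt0 // prod_gt0.
  - by move=> j; rewrite mulr_ge0 // ltW // prod_gt0.
  move=> t t0.
  (* The one-variable hypothesis in coordinate [e0] is the induction hypothesis at the points with
     that coordinate replaced by [t k]. *)
  pose xt k e := if e == e0 then t k else x k e.
  have xt0 k e : 0 < xt k e by rewrite /xt; case: eqP.
  have E1 k : \sum_j b k j * \prod_(e | e != e0) w S (x k) j e * t k ^+ d j e0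
      = \sum_j b k j * \prod_e w S (xt k) j e.
    by apply: eq_bigr => j _; rewrite split_e0 mulrA.
  have E2 : \sum_j bh j * \prod_(e | e != e0) w S xs j e * (\sum_k alpha k * t k) ^+ d j e0
      = \sum_j bh j * \prod_e w S (fun e => \sum_k alpha k * xt k e) j e.
    apply: eq_bigr => j _; rewrite -mulrA -split_e0; congr (_ * _); apply: eq_bigr => e _.
    by congr (w _ _ _ _); apply: funext => e'; rewrite /xt; case: eqP.
  by under eq_bigr => k _ do rewrite E1; rewrite E2; apply: IH.
have := claim (index_enum E) (fun _ _ => 1) (fun _ _ => ltr01).
have wE y j : \prod_e w (index_enum E) y j e = \prod_e (d j e)`!%:R.
  by apply: eq_bigr => e _; rewrite /w mem_index_enum.
under eq_bigr => k _ do under eq_bigr => j _ do rewrite wE.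
by under [in X in _ <= X]eq_bigr => j _ do rewrite wE.
Qed.

(** * Contingency tables *)

Lemma T_vsum (R : realType) (m n N : nat) (r : 'I_m -> nat) (c : 'I_n -> nat)
    (W : 'M[R]_(m, n)) : vsum r = N ->
  T r c W = \sum_(D : 'M['I_N.+1]_(m, n) | is_table r c D) \prod_i \prod_j W i j ^+ D i j.
Proof. by case: N /. Qed.

(** Existence follows from the capacity bound: (\sum_j y_j)^N dominates y^c, so P_{r,c} is positive
    at the all-ones matrix and its sum is not empty. *)
Lemma exists_table (R : realType) (m n N : nat) (r : 'I_m -> nat) (c : 'I_n -> nat) :
  vsum r = N -> vsum c = N -> (forall j, (0 < c j)%N) ->
  exists D : 'M['I_N.+1]_(m, n), is_table r c D.
Proof.
move=> rN cN c0; pose Z : 'M[R]_(m, n) := const_mx 1.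
have Z0 i j : 0 < Z i j by rewrite mxE.
have f0 d : 0 < (d`!)%:R^-1 :> R by rewrite invr_gt0 ltr0n fact_gt0.
pose K : R := \prod_i (r i)`!%:R^-1.
have K0 : 0 < K by apply: prodr_gt0 => i _.
have := @ctpoly_capacity R m n N r c Z K rN cN Z0 c0.
have -> : \prod_j ((c j ^ c j)%:R / (c j)`!%:R) = omega R c by [].
move=> h; have {}h : K * omega R c <= (N ^ N)%:R / N`!%:R * ctpoly N r c Z.
  apply: h => y y0; rewrite big_split /= mulrC ler_pM2r //.
  have -> : \prod_i (\sum_j y j * Z i j) ^+ r i = \prod_j (\sum_j' y j') ^+ c j.
    rewrite -expr_sum -/(vsum c) cN -rN /vsum expr_sum; apply: eq_bigr => i _.
    by congr (_ ^+ _); apply: eq_bigr => j _; rewrite mxE mulr1.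
  apply: ler_prod => j _; rewrite exprn_ge0 ?(ltW (y0 j)) //=.
  apply: lerXn2r; rewrite ?nnegrE ?(ltW (y0 j)) //.
    by apply: sumr_ge0 => j' _; apply: ltW.
  by rewrite (bigD1 j) //= lerDl; apply: sumr_ge0 => j' _; apply: ltW.
have : 0 < ctpoly N r c Z.
  rewrite lt_neqAle ctpoly_ge0 ?andbT; last by move=> i j; apply: ltW.
  apply: contraTneq h => <-; rewrite mulr0 -ltNge mulr_gt0 ?omega_gt0 //.
case: (boolP [exists D : 'M['I_N.+1]_(m, n), is_table r c D]) => [/existsP //|/existsPn no].
by rewrite /ctpoly big_pred0 ?ltxx // => D; apply/negbTE/no.
Qed.

(** The table condition is an indicator in the coefficient, so that all margins share one index set
    of monomials. *)
Lemma sum_table_monomial (R : realType) (m n N : nat) (r : 'I_m -> nat) (c : 'I_n -> nat)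
    (W : 'M[R]_(m, n)) (K : R) (v : 'M['I_N.+1]_(m, n) -> 'I_m * 'I_n -> R) :
  \sum_(D : 'M['I_N.+1]_(m, n))
     (K * (is_table r c D)%:R * \prod_i \prod_j (W i j ^+ D i j / (D i j)`!%:R)) * \prod_e v D e
  = K * \sum_(D : 'M['I_N.+1]_(m, n) | is_table r c D)
     \prod_i \prod_j (W i j ^+ D i j / (D i j)`!%:R * v D (i, j)).
Proof.
rewrite mulr_sumr [RHS]big_mkcond; apply: eq_bigr => D _.
case: (is_table r c D); last by rewrite mulr0 !mul0r.
rewrite mulr1 -mulrA; congr (_ * _).
have -> : \prod_e v D e = \prod_i \prod_j v D (i, j).
  by rewrite pair_bigA /=; apply: eq_bigr => -[].
by rewrite -big_split; apply: eq_bigr => i _; rewrite -big_split.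
Qed.

(** Prekopa-Leindler with one variable per entry and one monomial per matrix: factorials in place of
    powers yield T, and the pointwise hypothesis is the joint log-concavity of P at the matrices
    [Wx (x k)]. *)
Lemma T_logconcave_pos (R : realType) (m n p N : nat) (W : 'M[R]_(m, n))
  (Rk : 'I_p -> 'I_m -> nat) (Ck : 'I_p -> 'I_n -> nat) (alpha : 'I_p -> R)
  (Rv : 'I_m -> nat) (Cv : 'I_n -> nat) :
  (forall i j, 0 < W i j) ->
  (forall k i, (0 < Rk k i)%N) -> (forall k j, (0 < Ck k j)%N) ->
  (forall k, vsum (Rk k) = N) -> (forall k, vsum (Ck k) = N) ->
  (forall k, 0 <= alpha k) -> \sum_(k < p) alpha k = 1 ->
  (forall i, (Rv i)%:R = \sum_(k < p) alpha k * (Rk k i)%:R) ->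
  (forall j, (Cv j)%:R = \sum_(k < p) alpha k * (Ck k j)%:R) ->
  (forall i, (0 < Rv i)%N) -> (forall j, (0 < Cv j)%N) ->
  vsum Rv = N -> vsum Cv = N ->
  \prod_(k < p)
     powR (T (Rk k) (Ck k) W / Num.min (omega R (Rk k)) (omega R (Ck k))) (alpha k)
  <= (N ^ N)%N%:R / (N`!)%:R * (T Rv Cv W / (omega R Rv * omega R Cv)).
Proof.
move=> W0 Rk0 Ck0 RkN CkN al0 al1 RvE CvE Rv0 Cv0 RvN CvN.
have f0 d : 0 < (d`!)%:R :> R by rewrite ltr0n fact_gt0.
have Wc0 (D : 'M['I_N.+1]_(m, n)) : 0 < \prod_i \prod_j (W i j ^+ D i j / (D i j)`!%:R).
  by do 2!apply: prodr_gt0 => ? _; rewrite divr_gt0 ?exprn_gt0.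
pose mink k := Num.min (omega R (Rk k)) (omega R (Ck k)).
have mink0 k : 0 < (mink k)^-1 by rewrite invr_gt0 lt_min !omega_gt0.
pose C : R := (N ^ N)%:R / N`!%:R / (omega R Rv * omega R Cv).
have C0 : 0 <= C.
  by rewrite !divr_ge0 ?ler0n // mulr_ge0 // ltW ?omega_gt0.
pose b k (D : 'M['I_N.+1]_(m, n)) := (mink k)^-1 * (is_table (Rk k) (Ck k) D)%:R *
  \prod_i \prod_j (W i j ^+ D i j / (D i j)`!%:R).
pose bh (D : 'M['I_N.+1]_(m, n)) := C * (is_table Rv Cv D)%:R *
  \prod_i \prod_j (W i j ^+ D i j / (D i j)`!%:R).
have fact_cancel r c : \sum_(D : 'M['I_N.+1]_(m, n) | is_table r c D)
     \prod_i \prod_j (W i j ^+ D i j / (D i j)`!%:R * (D i j)`!%:R) =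
     \sum_(D : 'M['I_N.+1]_(m, n) | is_table r c D) \prod_i \prod_j W i j ^+ D i j.
  apply: eq_bigr => D _; apply: eq_bigr => i _; apply: eq_bigr => j _.
  by rewrite divfK // gt_eqF.
have E1 k : \sum_D b k D * \prod_e (D e.1 e.2)`!%:R = T (Rk k) (Ck k) W / mink k.
  by rewrite sum_table_monomial /= fact_cancel -(T_vsum _ _ (RkN k)) mulrC.
have E2 : \sum_D bh D * \prod_e (D e.1 e.2)`!%:R = C * T Rv Cv W.
  by rewrite sum_table_monomial /= fact_cancel -(T_vsum _ _ RvN).
pose Wx (x : 'I_m * 'I_n -> R) := \matrix_(i, j) (W i j * x (i, j)).
have ct r c x : \sum_(D : 'M['I_N.+1]_(m, n) | is_table r c D)
     \prod_i \prod_j (W i j ^+ D i j / (D i j)`!%:R * x (i, j) ^+ D i j) = ctpoly N r c (Wx x).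
  apply: eq_bigr => D _; apply: eq_bigr => i _; apply: eq_bigr => j _.
  by rewrite mxE exprMn mulrAC.
have E3 k x : \sum_D b k D * \prod_e x e ^+ D e.1 e.2
    = ctpoly N (Rk k) (Ck k) (Wx x) / mink k.
  by rewrite sum_table_monomial /= ct mulrC.
have E4 x : \sum_D bh D * \prod_e x e ^+ D e.1 e.2 = C * ctpoly N Rv Cv (Wx x).
  by rewrite sum_table_monomial /= ct.
have -> : (N ^ N)%:R / N`!%:R * (T Rv Cv W / (omega R Rv * omega R Cv)) = C * T Rv Cv W.
  by rewrite /C mulrA mulrAC.
rewrite -E2; under eq_bigr => k _ do rewrite -E1.
apply: (prekopa_leindler_exp al0 al1).
- by move=> k D; exact: mulr_ge0 (mulr_ge0 (ltW (mink0 k)) (ler0n _ _)) (ltW (Wc0 D)).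
(* Each pair of margins has a table, so no density vanishes identically. *)
- move=> k; have [D tD] := @exists_table R m n N _ _ (RkN k) (CkN k) (Ck0 k).
  by exists D; rewrite /b tD !mulr_gt0.
- by move=> D; exact: mulr_ge0 (mulr_ge0 C0 (ler0n _ _)) (ltW (Wc0 D)).
move=> x x0; rewrite E4; under eq_bigr => k _ do rewrite E3.
have -> : Wx (fun e => \sum_k alpha k * x k e) = \sum_k alpha k *: Wx (x k).
  apply/matrixP => i j; rewrite summxE mxE mulr_sumr; apply: eq_bigr => k _.
  by rewrite !mxE mulrCA.
by apply: ctpoly_logconcave => // k i j; rewrite mxE mulr_gt0.
Qed.

Theorem theorem2p1 (R : realType) (m n p N : nat) (W : 'M[R]_(m, n))
  (Rk : 'I_p -> 'I_m -> nat) (Ck : 'I_p -> 'I_n -> nat) (alpha : 'I_p -> R)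
  (Rv : 'I_m -> nat) (Cv : 'I_n -> nat) :
  (forall i j, 0 <= W i j) ->
  (forall k i, (0 < Rk k i)%N) -> (forall k j, (0 < Ck k j)%N) ->
  (forall k, vsum (Rk k) = N) -> (forall k, vsum (Ck k) = N) ->
  (forall k, 0 <= alpha k) -> \sum_(k < p) alpha k = 1 ->
  (forall i, (Rv i)%:R = \sum_(k < p) alpha k * (Rk k i)%:R) ->
  (forall j, (Cv j)%:R = \sum_(k < p) alpha k * (Ck k j)%:R) ->
  (forall i, (0 < Rv i)%N) -> (forall j, (0 < Cv j)%N) ->
  \prod_(k < p)
     powR (T (Rk k) (Ck k) W / Num.min (omega R (Rk k)) (omega R (Ck k))) (alpha k)
  <= (N ^ N)%N%:R / (N`!)%:R * (T Rv Cv W / (omega R Rv * omega R Cv)).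
Proof.
move=> W0 Rk0 Ck0 RkN CkN al0 al1 RvE CvE Rv0 Cv0.
have sumN (l : nat) (B : 'I_l -> nat) (Bk : 'I_p -> 'I_l -> nat) :
    (forall k, vsum (Bk k) = N) ->
    (forall i, (B i)%:R = \sum_(k < p) alpha k * (Bk k i)%:R) -> vsum B = N.
  move=> BkN BE; apply/eqP; rewrite -(eqr_nat R) /vsum natr_sum; apply/eqP.
  under eq_bigr => i _ do rewrite BE.
  rewrite exchange_big /= -[RHS]mul1r -[X in X * _]al1 mulr_suml; apply: eq_bigr => k _.
  by rewrite -mulr_sumr -natr_sum -/(vsum (Bk k)) BkN.
have RvN := sumN _ _ _ RkN RvE; have CvN := sumN _ _ _ CkN CvE.
set L := \prod_(k < p) _; set c := (N ^ N)%:R / N`!%:R : R.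
set o := omega R Rv * omega R Cv.
(* Zero entries are reached by continuity: P is the right-hand side for the matrix with entries w_ij
   + e, as a polynomial in e, and e tends to 0 from the right. *)
pose P : {poly R} := (c / o) *: \sum_(D : 'M['I_N.+1]_(m, n) | is_table Rv Cv D)
  \prod_i \prod_j ((W i j)%:P + 'X) ^+ D i j.
have PE e : P.[e] = c * (T Rv Cv (\matrix_(i, j) (W i j + e)) / o).
  rewrite hornerZ (T_vsum _ _ RvN) horner_sum mulrA mulrAC; congr (_ * _ / _).
  apply: eq_bigr => D _; rewrite horner_prod; apply: eq_bigr => i _.
  by rewrite horner_prod; apply: eq_bigr => j _; rewrite !hornerE mxE.
have -> : c * (T Rv Cv W / o) = P.[0].
  rewrite PE; do 2!congr (_ * _); congr (T _ _ _).
  by apply/matrixP => i j; rewrite mxE addr0.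
have P0 : P.[e] @[e --> 0^'+] --> P.[0].
  by apply: cvg_at_right_filter; apply: continuous_horner.
apply: (cvgr_to_ge P0); near=> e.
have e0 : 0 < e by near: e; apply: nbhs_right_gt.
pose We := \matrix_(i, j) (W i j + e).
have We0 i j : 0 < We i j by rewrite mxE ltr_wpDl.
rewrite PE -/We.
(* The left-hand side still has W; since T is monotone in the entries, it is at most its value at
   [We]. *)
apply: le_trans (T_logconcave_pos We0 Rk0 Ck0 RkN CkN al0 al1 RvE CvE Rv0 Cv0 RvN CvN).
have T_ge0 k (V : 'M[R]_(m, n)) : (forall i j, 0 <= V i j) -> 0 <= T (Rk k) (Ck k) V.
  move=> V0; apply: sumr_ge0 => D _; do 2!apply: prodr_ge0 => ? _; exact: exprn_ge0.
apply: ler_prod => k _; rewrite powR_ge0 /=.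
have mink0 : 0 < (Num.min (omega R (Rk k)) (omega R (Ck k)))^-1.
  by rewrite invr_gt0 lt_min !omega_gt0.
apply: ge0_ler_powR => //.
- by rewrite nnegrE mulr_ge0 ?T_ge0 // ltW.
- by rewrite nnegrE mulr_ge0 ?T_ge0 // => *; rewrite ltW.
rewrite ler_pM2r //; apply: ler_sum => D _.
apply: ler_prod => i _; apply/andP; split.
  by apply: prodr_ge0 => j _; apply: exprn_ge0.
apply: ler_prod => j _; rewrite exprn_ge0 //= lerXn2r ?nnegrE //; first by rewrite ltW.
by rewrite mxE lerDl ltW.
Unshelve. all: by end_near.
Qed.
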